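(* Let $p$ be an odd prime and let $\tau$ be a fixed non-square in $\mathbb{F}_p$, represented by an integer. Up to isomorphism, the powerful $p$-groups of type $(2,2,2)$ are exactly the following groups, which are pairwise non-isomorphic and $12+2(p-1)$ in number. In each case the group is the powerful $p$-group of order $p^6$ generated by elements $a_1,a_2,a_3$ with $a_1^{p^2}=a_2^{p^2}=a_3^{p^2}=1$ satisfying the listed relations: $A_1$: $[a_2,a_3]=a_1^{p}$, $[a_3,a_1]=a_2^{p}$, $[a_1,a_2]=a_3^{p}$; $A_2$: $[a_2,a_3]=a_2^{-p}$, $[a_3,a_1]=a_1^{p}$, $[a_1,a_2]=a_3^{p}$; $A_3$: $[a_2,a_3]=a_1^{p}a_2^{-p}$, $[a_3,a_1]=a_1^{p}$, $[a_1,a_2]=a_3^{p}$; $A_4$: $[a_2,a_3]=a_1^{p\tau}a_2^{-p}$, $[a_3,a_1]=a_1^{p}$, $[a_1,a_2]=a_3^{p}$; $A_5$: $[a_2,a_3]=a_2^{-p}a_3^{p}$, $[a_3,a_1]=a_1^{p}a_2^{p}$, $[a_1,a_2]=a_1^{p}$; $A_6(\alpha)$, $1\le\alpha\le p-2$: $[a_2,a_3]=a_1^{p\alpha}a_2^{-p}$, $[a_3,a_1]=a_1^{p}a_2^{p}$, $[a_1,a_2]=a_3^{p}$; $B_1$: $[a_2,a_3]=a_1^{-p}a_2^{-p}$, $[a_3,a_1]=a_1^{p}a_2^{p}$, $[a_1,a_2]=a_3^{p}$; $B_2$: $[a_2,a_3]=a_1^{p}$, $[a_3,a_1]=a_2^{p}$,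 $[a_1,a_2]=1$; $B_3$: $[a_2,a_3]=a_1^{p\tau}$, $[a_3,a_1]=a_2^{p}$, $[a_1,a_2]=1$; $B_4$: $[a_2,a_3]=a_2^{-p}$, $[a_3,a_1]=a_1^{p}$, $[a_1,a_2]=1$; $B_5$: $[a_2,a_3]=a_1^{p}a_2^{-p}$, $[a_3,a_1]=a_1^{p}$, $[a_1,a_2]=1$; $B_6$: $[a_2,a_3]=a_2^{-p}a_3^{p}$, $[a_3,a_1]=a_1^{p}$, $[a_1,a_2]=a_1^{p}$; $B_7(\alpha)$, $1\le\alpha\le p-2$: $[a_2,a_3]=a_1^{p\alpha}a_2^{-p}$, $[a_3,a_1]=a_1^{p}a_2^{p}$, $[a_1,a_2]=1$; $C_1$: $[a_2,a_3]=a_1^{-p}a_2^{-p}$, $[a_3,a_1]=a_1^{p}a_2^{p}$, $[a_1,a_2]=1$; $C_2$: $[a_2,a_3]=a_1^{p}$, $[a_3,a_1]=1$, $[a_1,a_2]=1$; $D$: $[a_2,a_3]=[a_3,a_1]=[a_1,a_2]=1$. Moreover, among these groups the powerfully simple ones are exactly $A_1,A_2,A_3,A_4,A_5$ and $A_6(\alpha)$ for $1\le\alpha\le p-2$, so that there are $5+(p-2)$ powerfully simple groups of order $p^6$.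
   Context: $G^{p}$ is the subgroup generated by all $p$-th powers of elements of $G$. A finite $p$-group $G$ is powerful if $[G,G]\le G^p$; a subgroup $H\le G$ is powerfully embedded in $G$ if $[H,G]\le H^p$. Every powerful $p$-group $G$ has a powerful basis, i.e. generators $a_1,\ldots,a_r$ with $G=\langle a_1\rangle\cdots\langle a_r\rangle$ and $|G|=o(a_1)\cdots o(a_r)$; the number of generators of each order is an invariant of $G$. $G$ is of type $(2,\stackrel{r}{\ldots},2)$ if a powerful basis consists of $r$ elements, all of order $p^2$. $\mathcal{P}$ is the class of all powerful $p$-groups of type $(2,\ldots,2)$, the trivial group being included; members of $\mathcal P$ of order $p^6$ are those of type $(2,2,2)$. $H\lhd_{\mathcal P}G$ means $H,G\in\mathcal{P}$, $H<G$ and $H$ is powerfully embedded in $G$. A group $G\in\mathcal{P}$ is powerfully simple if $G\ne1$ and $H\lhd_{\mathcal P}G$ implies $H=1$. For each set of relations listed in the claim there is a unique (up to isomorphism) powerful $p$-group of order $p^6$ generated by elements $a_1,a_2,a_3$ of order $p^2$ satisfying them. *)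

(* Defs.v *)
From HB Require Import structures.
From mathcomp Require Import all_boot all_order all_algebra all_fingroup all_solvable.

Set Implicit Arguments.
Unset Strict Implicit.
Unset Printing Implicit Defensive.

Import GroupScope.

Section Powerful.

Variables (gT : finGroupType) (p : nat).
Implicit Types (G H : {set gT}) (s : seq gT).

Definition pth_powers G : {set gT} := <<[set x ^+ p | x in G]>>.

(* For odd p; at p = 2 the usual definition has the fourth powers instead. *)
Definition powerful G : Prop :=
  p.-group G /\ [~: G, G] \subset pth_powers G.

Definition powerfully_embedded H G : Prop :=
  H \subset G /\ [~: H, G] \subset pth_powers H.

(* The big product is the product of subsets, in the order of s, so that the
   first condition also says that s generates G. *)
Definition powerful_basis G s : Prop :=
  G = \prod_(a <- s) <[a]> /\ #|G| = (\prod_(a <- s) #[a])%N.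

(* Type (2, ..., 2) with r twos. *)
Definition type_twos (r : nat) G : Prop :=
  powerful G /\
  exists2 s : r.-tuple gT,
    powerful_basis G s & forall a, a \in s -> #[a] = (p ^ 2)%N.

(* For r = 0 the basis is empty and G is trivial. *)
Definition class_P G : Prop := exists r, type_twos r G.

Definition normal_P H G : Prop :=
  [/\ class_P H, class_P G, H \proper G & powerfully_embedded H G].

Definition powerfully_simple (G : {group gT}) : Prop :=
  [/\ class_P G, G :!=: 1 &
      forall H : {group gT}, normal_P H G -> H :=: 1].

End Powerful.

Definition expgz (gT : finGroupType) (x : gT) (z : int) : gT :=
  match z with
  | Posz n => x ^+ n
  | Negz n => x ^- n.+1
  end.

(* In A6 and B7 the index i : 'I_(p - 2) encodes the parameter alpha = i + 1,
   so that 1 <= alpha <= p - 2. *)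
Inductive label (p : nat) : Type :=
| A1 | A2 | A3 | A4 | A5 | A6 of 'I_(p - 2)
| B1 | B2 | B3 | B4 | B5 | B6 | B7 of 'I_(p - 2)
| C1 | C2
| D.

Arguments A1 {p}. Arguments A2 {p}. Arguments A3 {p}. Arguments A4 {p}.
Arguments A5 {p}. Arguments A6 {p}.
Arguments B1 {p}. Arguments B2 {p}. Arguments B3 {p}. Arguments B4 {p}.
Arguments B5 {p}. Arguments B6 {p}. Arguments B7 {p}.
Arguments C1 {p}. Arguments C2 {p}. Arguments D {p}.

Definition label_code (p : nat) (l : label p) : nat + ('I_(p - 2) + 'I_(p - 2)) :=
  match l with
  | A1 => inl 0 | A2 => inl 1 | A3 => inl 2 | A4 => inl 3 | A5 => inl 4
  | A6 i => inr (inl i)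
  | B1 => inl 5 | B2 => inl 6 | B3 => inl 7 | B4 => inl 8 | B5 => inl 9
  | B6 => inl 10
  | B7 i => inr (inr i)
  | C1 => inl 11 | C2 => inl 12
  | D => inl 13
  end%N.

Definition label_list (p : nat) : seq (label p) :=
  [:: A1; A2; A3; A4; A5; B1; B2; B3; B4; B5; B6; C1; C2; D].

Definition label_decode (p : nat) (c : nat + ('I_(p - 2) + 'I_(p - 2))) : label p :=
  match c with
  | inl k => nth D (label_list p) k
  | inr (inl i) => A6 i
  | inr (inr i) => B7 i
  end.

Lemma label_codeK (p : nat) : cancel (@label_code p) (@label_decode p).
Proof. by case. Qed.

HB.instance Definition _ (p : nat) := Countable.copy (label p) (can_type (@label_codeK p)).

Definition label_enum (p : nat) : seq (label p) :=
  label_list p ++ [seq A6 i | i <- enum 'I_(p - 2)]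
               ++ [seq B7 i | i <- enum 'I_(p - 2)].

Lemma label_enumP (p : nat) : Finite.axiom (label_enum p).
Proof.
have A6_inj : injective (@A6 p) by move=> i j [].
have B7_inj : injective (@B7 p) by move=> i j [].
have A6F l : (forall i, l != A6 i) -> count_mem l [seq A6 i | i <- enum 'I_(p - 2)] = 0.
  by move=> h; apply/count_memPn/negP => /mapP[i _ E]; case/eqP: (h i).
have B7F l : (forall i, l != B7 i) -> count_mem l [seq B7 i | i <- enum 'I_(p - 2)] = 0.
  by move=> h; apply/count_memPn/negP => /mapP[i _ E]; case/eqP: (h i).
case=> [|||||i|||||||i|||]; rewrite !count_cat;
  try by rewrite A6F ?B7F //.
- rewrite B7F // (count_uniq_mem _ (_ : uniq [seq A6 i | i <- enum 'I_(p - 2)])).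
    by rewrite map_f ?mem_enum.
  by rewrite map_inj_uniq ?enum_uniq.
- rewrite A6F // (count_uniq_mem _ (_ : uniq [seq B7 i | i <- enum 'I_(p - 2)])).
    by rewrite map_f ?mem_enum.
  by rewrite map_inj_uniq ?enum_uniq.
Qed.

HB.instance Definition _ (p : nat) := isFinite.Build (label p) (@label_enumP p).

Definition is_A (p : nat) (l : label p) : bool :=
  match l with
  | A1 | A2 | A3 | A4 | A5 | A6 _ => true
  | _ => false
  end.

(* The prescribed values of [~ a2, a3], [~ a3, a1] and [~ a1, a2]. *)
Definition commutator_values (gT : finGroupType) (p : nat) (tau : int)
    (l : label p) (a1 a2 a3 : gT) : gT * gT * gT :=
  match l with
  | A1   => (a1 ^+ p, a2 ^+ p, a3 ^+ p)
  | A2   => (a2 ^- p, a1 ^+ p, a3 ^+ p)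
  | A3   => (a1 ^+ p * a2 ^- p, a1 ^+ p, a3 ^+ p)
  | A4   => (expgz a1 (p%:Z * tau)%R * a2 ^- p, a1 ^+ p, a3 ^+ p)
  | A5   => (a2 ^- p * a3 ^+ p, a1 ^+ p * a2 ^+ p, a1 ^+ p)
  | A6 i => (a1 ^+ (p * i.+1) * a2 ^- p, a1 ^+ p * a2 ^+ p, a3 ^+ p)
  | B1   => (a1 ^- p * a2 ^- p, a1 ^+ p * a2 ^+ p, a3 ^+ p)
  | B2   => (a1 ^+ p, a2 ^+ p, 1)
  | B3   => (expgz a1 (p%:Z * tau)%R, a2 ^+ p, 1)
  | B4   => (a2 ^- p, a1 ^+ p, 1)
  | B5   => (a1 ^+ p * a2 ^- p, a1 ^+ p, 1)
  | B6   => (a2 ^- p * a3 ^+ p, a1 ^+ p, a1 ^+ p)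
  | B7 i => (a1 ^+ (p * i.+1) * a2 ^- p, a1 ^+ p * a2 ^+ p, 1)
  | C1   => (a1 ^- p * a2 ^- p, a1 ^+ p * a2 ^+ p, 1)
  | C2   => (a1 ^+ p, 1, 1)
  | D    => (1, 1, 1)
  end.

Definition satisfies_relations (gT : finGroupType) (p : nat) (tau : int)
    (l : label p) (G : {group gT}) : Prop :=
  [/\ powerful p G, #|G| = (p ^ 6)%N &
      exists a1 a2 a3 : gT,
        [/\ <<[set a1; a2; a3]>> = G,
            [/\ a1 ^+ (p ^ 2) = 1, a2 ^+ (p ^ 2) = 1 & a3 ^+ (p ^ 2) = 1] &
            ([~ a2, a3], [~ a3, a1], [~ a1, a2])
              = commutator_values tau l a1 a2 a3]].

(* Main.v *)
Require Import Defs.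
From HB Require Import structures.
From mathcomp Require Import all_boot all_order all_algebra all_fingroup all_solvable.
From mathcomp Require Import ring zify.

Set Implicit Arguments.
Unset Strict Implicit.
Unset Printing Implicit Defensive.

Import GroupScope.

(** A powerful group G of type (2,2,2) has G^p = Mho_1(G) central of exponent p, and the
    p-th power map identifies V = G/G^p = F_p^3 with G^p.  Hence G is determined by the
    3x3 matrix A whose rows express [a2,a3], [a3,a1], [a1,a2] in a1^p, a2^p, a3^p, and
    every A occurs: take (Z/p^2)^3 with the addition twisted by p times a bilinear map.
    A base change P turns A into the B with cof(P) A = B P, i.e. det(P) A = P^T B P, and
    rescaling P absorbs the determinant, so the isomorphism classes are the matrices
    over F_p up to congruence and scaling.

    Write A = (S + N)/2 with S symmetric and N skew, and let n be the vector of entries of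
    N, which spans ker N when N <> 0.  Splitting off a vector of ker N that is not
    S-isotropic leaves a binary form under SL_2, classified by its rank and discriminant;
    the only other case is S(n,n) = 0 with S(n,-) <> 0, which gives A_5 and B_6.  The matrices are told apart by the vanishing
    of n, S, adj S, det S, S(n,n), S n, by the ratios det S : S(n,n) and adj S : n n^T,
    and by whether adj S has the form v v^T.

    A proper nontrivial member of the class that is powerfully embedded in G is a proper
    nonzero W <= V with (w x v) A in W for all w in W and v in V; one exists if and only
    if det A = 0. *)

(** * The p-th powers of a powerful group *)

Section PowerfulStructure.

Variables (gT : finGroupType) (p : nat).
Hypotheses (p_pr : prime p) (p_odd : odd p).
Implicit Types G H : {group gT}.

Lemma pth_powersE G : p.-group G -> pth_powers p G = 'Mho^1(G).
Proof. by move=> pG; rewrite (MhoE 1 pG) expn1. Qed.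

Lemma dvdp_bin2 : p %| 'C(p, 2).
Proof. by rewrite prime_dvd_bin //= ltnNge; case: p p_pr p_odd => [|[|[|]]]. Qed.

(** The correction term is the commutator raised to ['C(p, 2)], a multiple of [p] because [p] is
    odd. *)
Lemma expgM_class2 (x y : gT) :
  commute x [~ y, x] -> commute y [~ y, x] -> [~ y, x] ^+ p = 1 ->
  (x * y) ^+ p = x ^+ p * y ^+ p.
Proof.
move=> cx cy c1; rewrite expMg_Rmul //.
by have /dvdnP[k ->] := dvdp_bin2; rewrite mulnC expgM c1 expg1n mulg1.
Qed.

End PowerfulStructure.

Section PowerfulGenerators.

Variables (p : nat).
Hypotheses (p_pr : prime p) (p_odd : odd p).

Lemma mho_exp (gT : finGroupType) (G : {group gT}) x :
  p.-group G -> x \in G -> x ^+ p \in 'Mho^1(G).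
Proof. by move=> pG Gx; rewrite -[p]expn1 Mho_p_elt ?(mem_p_elt pG). Qed.

Lemma mho1_exp (gT : finGroupType) (G : {group gT}) x :
  p.-group G -> 'Mho^1(G) = 1 -> x \in G -> x ^+ p = 1.
Proof. by move=> pG G1 /(mho_exp pG); rewrite G1 => /set1P. Qed.

Lemma quotient_mho (gT : finGroupType) (G H : {group gT}) :
  G \subset 'N(H) -> 'Mho^1(G / H) = 'Mho^1(G) / H.
Proof. by move=> nHG; rewrite /quotient morphim_Mho. Qed.

(** Conjugating [x] by [y] multiplies it by [z = [~ x, y]], which lies in ['Mho^1(G)]. Since
    [z ^+ p = 1] and [[~ z, x]] is central, the p-th power of the conjugate is again [x ^+ p]. *)
Lemma mho_central_step (gT : finGroupType) (G : {group gT}) :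
    p.-group G -> G^`(1) \subset 'Mho^1(G) -> 'Mho^1('Mho^1(G)) = 1 ->
  [~: 'Mho^1(G), G, G] = 1 -> [~: 'Mho^1(G), G] = 1.
Proof.
move=> pG sGN N1 NGG.
have pN : p.-group 'Mho^1(G) by apply: pgroupS pG; apply: Mho_sub.
apply/commG1P; rewrite -(pth_powersE pG) gen_subG.
apply/subsetP=> _ /imsetP[x Gx ->]; apply/centP=> y Gy.
pose z := [~ x, y].
have Nz : z \in 'Mho^1(G) by rewrite (subsetP sGN) // mem_commg.
have zp : z ^+ p = 1 by exact: mho1_exp pN N1 _.
have Zzx u : u \in G -> commute u [~ z, x].
  move=> Gu; apply/commute_sym/(centP _ _ Gu).
  have /commG1P/subsetP := NGG; apply; exact: mem_commg.
have Gz : z \in G by rewrite groupR.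
have zxp : [~ z, x] ^+ p = 1 by rewrite -commXg ?zp ?comm1g //; apply: Zzx.
apply/commgP/conjg_fixP; rewrite conjXg conjg_mulR -/z.
by rewrite expgM_class2 ?zp ?mulg1 //; apply: Zzx.
Qed.

(** If [[~: 'Mho^1(G), G]] is nontrivial, nilpotency makes [[~: 'Mho^1(G), G, G]] a proper subgroup
    of it. Modulo the latter [mho_central_step] applies and shows that the two coincide, a
    contradiction. *)
Lemma mho_central (gT : finGroupType) (G : {group gT}) :
    p.-group G -> G^`(1) \subset 'Mho^1(G) -> 'Mho^1('Mho^1(G)) = 1 ->
  [~: 'Mho^1(G), G] = 1.
Proof.
move=> pG sGN N1; apply/eqP/idPn => ntK.
have nsN : 'Mho^1(G) <| G := Mho_normal 1 G.
have sKG : [~: 'Mho^1(G), G] \subset G.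
  by rewrite (subset_trans (commSg _ (normal_sub nsN))) // -derg1 der_sub.
have nKG : G \subset 'N([~: 'Mho^1(G), G]) by rewrite normsR ?normG // normal_norm.
have /andP[_ /negP[]] : [~: 'Mho^1(G), G, G] \proper [~: 'Mho^1(G), G].
  by apply: nil_comm_properl (pgroup_nil pG) _ ntK _; rewrite ?subsetI ?subxx.
set L := [~: _, G, G].
have nLG : G \subset 'N(L) by rewrite normsR ?normG.
have sNG := normal_sub nsN; have sKK : [~: 'Mho^1(G), G] \subset 'N(L) by apply: subset_trans nLG.
have sNL : 'Mho^1(G) \subset 'N(L) by apply: subset_trans nLG.
rewrite -quotient_sub1 // quotientR // -quotient_mho //; apply/trivgP.
have eN : 'Mho^1(G / L) = 'Mho^1(G) / L by rewrite quotient_mho.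
apply: mho_central_step.
- exact: quotient_pgroup.
- by rewrite eN -quotient_der // quotientS.
- by rewrite eN quotient_mho // N1 quotient1.
- by rewrite eN -!quotientR // -/L trivg_quotient.
Qed.

(** This is [mho_central] in the quotient by ['Mho^1('Mho^1(G))]. *)
Lemma mho_powerfully_embedded (gT : finGroupType) (G : {group gT}) :
    p.-group G -> G^`(1) \subset 'Mho^1(G) ->
  [~: 'Mho^1(G), G] \subset 'Mho^1('Mho^1(G)).
Proof.
move=> pG sGN.
have nMG : G \subset 'N('Mho^1('Mho^1(G))) by rewrite !gFnorm_trans ?normG.
have sNG := Mho_sub 1 G.
have sNM := subset_trans sNG nMG.
have sKM : [~: 'Mho^1(G), G] \subset 'N('Mho^1('Mho^1(G))).
  by rewrite (subset_trans _ nMG) // (subset_trans (commSg _ sNG)) // -derg1 der_sub.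
have eN : 'Mho^1(G / 'Mho^1('Mho^1(G))) = 'Mho^1(G) / 'Mho^1('Mho^1(G)) by rewrite quotient_mho.
rewrite -quotient_sub1 // quotientR // -eN; apply/trivgP.
apply: mho_central.
- exact: quotient_pgroup.
- by rewrite eN -quotient_der // quotientS.
- by rewrite eN quotient_mho // trivg_quotient.
Qed.

Lemma expgM_powerful (gT : finGroupType) (G : {group gT}) :
    p.-group G -> G^`(1) \subset 'Mho^1(G) -> 'Mho^1('Mho^1(G)) = 1 ->
  {in G &, {morph (fun x => x ^+ p) : x y / x * y}}.
Proof.
move=> pG sGN N1 x y Gx Gy /=.
have pN : p.-group 'Mho^1(G) by apply: pgroupS pG; apply: Mho_sub.
have Nz : [~ y, x] \in 'Mho^1(G) by rewrite (subsetP sGN) // mem_commg.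
have Zz u : u \in G -> commute u [~ y, x].
  move=> Gu; apply/commute_sym/(centP _ _ Gu).
  by have /commG1P/subsetP := mho_central pG sGN N1; apply.
rewrite expgM_class2 //; try exact: Zz.
exact: mho1_exp pN N1 _.
Qed.

(** Modulo [M = 'Mho^1('Mho^1(G))] the p-th power map is a morphism, so the p-th powers of [S]
    generate ['Mho^1(G)] up to [M]. As [M] lies in the Frattini subgroup of ['Mho^1(G)], it consists
    of non-generators. *)
Lemma mho_gen (gT : finGroupType) (G : {group gT}) (S : {set gT}) :
    p.-group G -> G^`(1) \subset 'Mho^1(G) -> <<S>> = G ->
  'Mho^1(G) = <<[set x ^+ p | x in S]>>.
Proof.
move=> pG sGN defG.
have sSG : S \subset G by rewrite -defG subset_gen.
have pN : p.-group 'Mho^1(G) by apply: pgroupS pG; apply: Mho_sub.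
set T := [set x ^+ p | x in S].
have sTN : <<T>> \subset 'Mho^1(G).
  by rewrite gen_subG; apply/subsetP=> _ /imsetP[x Sx ->]; rewrite mho_exp ?(subsetP sSG).
set M := 'Mho^1('Mho^1(G))%G.
have nMG : G \subset 'N(M) by rewrite !gFnorm_trans ?normG.
have sNG := Mho_sub 1 G.
have eN : 'Mho^1(G / M) = 'Mho^1(G) / M by rewrite quotient_mho.
have pGM : p.-group (G / M) by apply: quotient_pgroup.
have H1 : (G / M)^`(1) \subset 'Mho^1(G / M) by rewrite eN -quotient_der // quotientS.
have H2 : 'Mho^1('Mho^1(G / M)) = 1.
  by rewrite eN quotient_mho ?trivg_quotient // (subset_trans sNG).
have pM := expgM_powerful pGM H1 H2.
pose f := Morphism pM.
have sNTM : 'Mho^1(G) / M \subset <<T>> / M.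
  rewrite -eN (MhoE 1 pGM) expn1 gen_subG.
  have -> : [set x ^+ p | x in G / M] = f @* (G / M).
    by rewrite morphimEdom.
  have sSM : S \subset 'N(M) by apply: subset_trans nMG.
  have eGM : G / M = <<S / M>> by rewrite -quotient_gen ?defG.
  rewrite [X in f @* X]eGM morphim_gen; last first.
    by apply: subset_trans (subset_gen _) _; rewrite -eGM.
  rewrite gen_subG; apply/subsetP=> _ /morphimP[y Gy /morphimP[x Nx Sx ->] ->] /=.
  by rewrite -morphX // mem_quotient // mem_gen //; apply: imset_f.
have /Phi_nongen <- // : 'Phi('Mho^1(G)) <*> T = 'Mho^1(G).
  apply/eqP; rewrite eqEsubset join_subG Phi_sub -gen_subG sTN /=.
  move: sNTM; rewrite quotientSK; last exact: subset_trans nMG.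
  move/subset_trans; apply; rewrite mul_subG //; last by rewrite genS ?subsetUr.
  apply: subset_trans (joing_subl _ _).
  by rewrite (Phi_joing pN) joing_subr.
Qed.

(** Applying [mho_gen] twice, ['Mho^1('Mho^1(G))] is generated by the elements [x ^+ (p ^ 2)] with
    [x] in [S], hence trivial; the other claims follow from this. *)
Lemma powerful_gen_exp2 (gT : finGroupType) (G : {group gT}) (S : {set gT}) :
    powerful p G -> <<S>> = G -> (forall x, x \in S -> x ^+ (p ^ 2) = 1) ->
  [/\ 'Mho^1(G) = <<[set x ^+ p | x in S]>>, 'Mho^1('Mho^1(G)) = 1,
      G^`(1) \subset 'Mho^1(G), 'Mho^1(G) \subset 'C(G) &
      {in G &, {morph (fun x => x ^+ p) : x y / x * y}}].
Proof.
case=> pG; rewrite pth_powersE // -derg1 => sGN defG S2.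
have eN := mho_gen pG sGN defG.
have emb := mho_powerfully_embedded pG sGN.
have N1 : 'Mho^1('Mho^1(G)) = 1.
  rewrite (@mho_gen _ 'Mho^1(G)%G [set x ^+ p | x in S]) //=.
  - apply/trivgP; rewrite gen_subG; apply/subsetP=> _ /imsetP[_ /imsetP[x Sx ->] ->].
    by rewrite -expgM mulnn S2 ?inE.
  - by apply: pgroupS pG; apply: Mho_sub.
  - by apply: subset_trans emb; rewrite derg1 commgS ?Mho_sub.
split=> //; last exact: expgM_powerful.
by apply/commG1P/trivgP; rewrite -N1.
Qed.

End PowerfulGenerators.

(** * Matrices of order 3 up to congruence and scaling *)

Section Matrices3.

Import GRing.Theory.
Local Open Scope ring_scope.

Section Ring.

Variable R : comNzRingType.

Definition mx3 (a b c d e f g h i : R) : 'M[R]_3 :=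
  \matrix_(r < 3, s < 3)
    nth 0 (nth [::] [:: [:: a; b; c]; [:: d; e; f]; [:: g; h; i]] r) s.

Lemma ord3P (P : 'I_3 -> Prop) :
  P 0 -> P 1 -> P (2%:R) -> forall i, P i.
Proof.
by move=> P0 P1 P2 [[|[|[|//]]] lt]; rewrite (bool_irrelevance lt isT);
  [move: P0 | move: P1 | move: P2]; congr P; apply: val_inj.
Qed.

Lemma big_ord3 (V : nmodType) (F : 'I_3 -> V) : \sum_i F i = F 0 + F 1 + F (2%:R).
Proof.
rewrite !big_ord_recl big_ord0 addr0 addrA; congr (_ + F _ + F _); exact: val_inj.
Qed.

Lemma mx3E (A : 'M[R]_3) :
  A = mx3 (A 0 0) (A 0 1) (A 0 (2%:R)) (A 1 0) (A 1 1) (A 1 (2%:R))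
          (A (2%:R) 0) (A (2%:R) 1) (A (2%:R) (2%:R)).
Proof. by apply/matrixP; do 2!apply: ord3P; rewrite mxE. Qed.

Lemma mx3_mul a b c d e f g h i a' b' c' d' e' f' g' h' i' :
  mx3 a b c d e f g h i *m mx3 a' b' c' d' e' f' g' h' i' =
  mx3 (a * a' + b * d' + c * g') (a * b' + b * e' + c * h') (a * c' + b * f' + c * i')
      (d * a' + e * d' + f * g') (d * b' + e * e' + f * h') (d * c' + e * f' + f * i')
      (g * a' + h * d' + i * g') (g * b' + h * e' + i * h') (g * c' + h * f' + i * i').
Proof. by apply/matrixP; do 2!apply: ord3P; rewrite !mxE big_ord3 !mxE. Qed.

Lemma mx3_tr a b c d e f g h i : (mx3 a b c d e f g h i)^T = mx3 a d g b e h c f i.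
Proof. by apply/matrixP; do 2!apply: ord3P; rewrite !mxE. Qed.

Lemma mx3_add a b c d e f g h i a' b' c' d' e' f' g' h' i' :
  mx3 a b c d e f g h i + mx3 a' b' c' d' e' f' g' h' i' =
  mx3 (a + a') (b + b') (c + c') (d + d') (e + e') (f + f') (g + g') (h + h') (i + i').
Proof. by apply/matrixP; do 2!apply: ord3P; rewrite !mxE. Qed.

Lemma mx3_scale k a b c d e f g h i :
  k *: mx3 a b c d e f g h i =
  mx3 (k * a) (k * b) (k * c) (k * d) (k * e) (k * f) (k * g) (k * h) (k * i).
Proof. by apply/matrixP; do 2!apply: ord3P; rewrite !mxE. Qed.

Lemma mx3_det a b c d e f g h i :
  \det (mx3 a b c d e f g h i) =
  a * (e * i - f * h) - b * (d * i - f * g) + c * (d * h - e * g).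
Proof.
rewrite (expand_det_row _ 0) big_ord3 /cofactor.
do 3!rewrite (expand_det_row _ 0) !big_ord_recl big_ord0 /cofactor !det_mx11 !mxE /=.
rewrite /bump /= !addn0 ?expr0 ?expr1 ?exprS; ring.
Qed.

End Ring.

(** * Normal forms under congruence and scaling *)

Section Field.

Variable F : fieldType.
Implicit Types A B Q : 'M[F]_3.

Definition sim A B : Prop :=
  exists c Q, [/\ c != 0, Q \in unitmx & B = c *: (Q^T *m A *m Q)].

Lemma sim_refl A : sim A A.
Proof. by exists 1, 1%:M; rewrite oner_neq0 unitmx1 trmx1 mul1mx mulmx1 scale1r. Qed.

Lemma sim_trans A B C : sim A B -> sim B C -> sim A C.
Proof.
move=> [c [Q [c0 uQ ->]]] [d [P [d0 uP ->]]]; exists (d * c), (Q *m P).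
rewrite mulf_neq0 // unitmx_mul uQ uP; split=> //.
by rewrite -scalemxAr -scalemxAl scalerA trmx_mul !mulmxA.
Qed.

Lemma sim_sym A B : sim A B -> sim B A.
Proof.
move=> [c [Q [c0 uQ ->]]]; exists c^-1, (invmx Q).
rewrite invr_eq0 c0 unitmx_inv uQ; split=> //.
rewrite -scalemxAr -scalemxAl scalerA mulVf // scale1r !mulmxA.
by rewrite -trmx_mul mulmxV // trmx1 mul1mx mulmxK.
Qed.

(** With the nine entries explicit and invertibility stated as a polynomial, the side conditions are
    within reach of [ring] and [field]. *)
Lemma sim3 c a11 a12 a13 a21 a22 a23 a31 a32 a33 A B :
    let Q := mx3 a11 a12 a13 a21 a22 a23 a31 a32 a33 in
    c != 0 ->
    a11 * (a22 * a33 - a23 * a32) - a12 * (a21 * a33 - a23 * a31)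
      + a13 * (a21 * a32 - a22 * a31) != 0 ->
  B = c *: (Q^T *m A *m Q) -> sim A B.
Proof. by move=> Q c0 q0 ->; exists c, Q; rewrite unitmxE mx3_det unitfE. Qed.

(** The orthogonal sum of a binary form, with symmetric coefficients [a], [b], [d] and skew part
    [m], and the unary form [s]. A change of the first two coordinates multiplies [m] by its
    determinant. *)
Definition blk a b d m s : 'M[F]_3 := mx3 a (b - m) 0 (b + m) d 0 0 0 s.

Definition mx3s := (mx3_tr, mx3_mul, mx3_scale).

Hypothesis two_neq0 : 2%:R != 0 :> F.
Hypothesis universal : forall k w : F, k != 0 -> exists x y, x ^+ 2 + k * y ^+ 2 = w.

(** The vector (x, y) is completed by one orthogonal to it for the symmetric part; the determinant
    of the change is [q], that is 1, so [m] is kept. *)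
Lemma blk_unit_vector a b d m s x y :
    a * x ^+ 2 + 2%:R * b * x * y + d * y ^+ 2 = 1 ->
  sim (blk a b d m s) (blk (a * d - b ^+ 2) 0 1 m s).
Proof.
set q := _ + _ + _ => q1.
(* With the factors [q] inserted, the congruence is an identity of polynomials. *)
have -> : blk (a * d - b ^+ 2) 0 1 m s = blk ((a * d - b ^+ 2) * q) 0 q (m * q) s.
  by rewrite q1 !mulr1.
apply: (@sim3 1 (b * x + d * y) x 0 (- (a * x + b * y)) y 0 0 0 1).
- exact: oner_neq0.
- rewrite (_ : _ + _ = q); [by rewrite q1 oner_neq0 | by rewrite /q; ring].
by rewrite /blk !mx3s /q; congr mx3; ring.
Qed.

(** A nondegenerate binary form represents 1, and a degenerate one is a multiple of a single square.
    Every change used has determinant 1 and so keeps [m]. *)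
Lemma blk_diag a b d m s : exists a' d',
  [/\ sim (blk a b d m s) (blk a' 0 d' m s) & d' = 0 \/ a' != 0 /\ d' = 1].
Proof.
have [D0|D0] := eqVneq (a * d - b ^+ 2) 0; last first.
  exists (a * d - b ^+ 2), 1; split; last by right.
  suff [x [y xy]] : exists x y, a * x ^+ 2 + 2%:R * b * x * y + d * y ^+ 2 = 1.
    exact: blk_unit_vector xy.
  have [a0|a0] := eqVneq a 0; last first.
    (* By completing the square, [a] times the form is (a x + b y)^2 + (a d - b^2) y^2, so it
       suffices to represent [a] by X^2 + (a d - b^2) Y^2. *)
    have [X [Y XY]] := universal a D0.
    exists ((X - b * Y) / a), Y; apply: (mulfI a0).
    rewrite mulr1 -[RHS]XY; field; exact: a0.
  have [d0|d0] := eqVneq d 0; last first.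
    have [X [Y XY]] := universal d D0.
    exists Y, ((X - b * Y) / d); apply: (mulfI d0).
    rewrite mulr1 -[RHS]XY; field; exact: d0.
  have b0 : b != 0 by apply: contraNneq D0 => ->; rewrite a0 d0 mul0r expr0n subr0.
  exists (2%:R * b)^-1, 1; rewrite a0 d0; field; by rewrite two_neq0 b0.
have [a0|a0] := eqVneq a 0; last first.
  exists a, 0; split; last by left.
  have -> : blk a 0 0 m s = blk a 0 ((a * d - b ^+ 2) / a) m s by rewrite D0 mul0r.
  apply: (@sim3 1 1 (- b / a) 0 0 1 0 0 0 1); first exact: oner_neq0.
    by rewrite (_ : _ + _ = 1) ?oner_neq0 //; ring.
  by rewrite /blk !mx3s; congr mx3; field.
have b0 : b = 0.
  by move/eqP: D0; rewrite a0 mul0r sub0r oppr_eq0 sqrf_eq0 => /eqP.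
exists d, 0; split; last by left.
apply: (@sim3 1 0 1 0 (-1) 0 0 0 0 1); first exact: oner_neq0.
  by rewrite (_ : _ + _ = 1) ?oner_neq0 //; ring.
by rewrite /blk !mx3s a0 b0; congr mx3; ring.
Qed.

Lemma blk_scale a b d m s : exists a' b' d' m' s',
  sim (blk a b d m s) (blk a' b' d' m' s') /\ (m' = 0 \/ m' = 1) /\ (s' = 0 \/ s' = 1).
Proof.
have [m0|m0] := eqVneq m 0; have [s0|s0] := eqVneq s 0.
- by exists a, b, d, m, s; split; [exact: sim_refl | tauto].
- exists (a / s), (b / s), (d / s), 0, 1; split; last by tauto.
  apply: (@sim3 s^-1 1 0 0 0 1 0 0 0 1); first by rewrite invr_eq0.
    by rewrite (_ : _ + _ = 1) ?oner_neq0 //; ring.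
  by rewrite /blk !mx3s m0; congr mx3; field.
- exists (a / m), (b / m), (d / m), 1, 0; split; last by tauto.
  apply: (@sim3 m^-1 1 0 0 0 1 0 0 0 1); first by rewrite invr_eq0.
    by rewrite (_ : _ + _ = 1) ?oner_neq0 //; ring.
  by rewrite /blk !mx3s s0; congr mx3; field.
exists (a * s / m ^+ 2), (b / m), (d / s), 1, 1; split; last by tauto.
apply: (@sim3 s^-1 (s / m) 0 0 0 1 0 0 0 1); first by rewrite invr_eq0.
  by rewrite (_ : _ + _ = s / m) ?mulf_neq0 ?invr_eq0 //; ring.
by rewrite /blk !mx3s; congr mx3; field; rewrite ?m0 ?s0.
Qed.

Variable t : F.
Hypothesis square_classes : forall x : F, x != 0 -> exists y, x = y ^+ 2 \/ x = t * y ^+ 2.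

(* The family [LA6] contains the matrix of B_1 (k = -1) and [LB7] that of C_1. *)
Inductive listed : 'M[F]_3 -> Prop :=
| LA1 : listed (blk 1 0 1 0 1)
| LA2 : listed (blk 0 0 0 1 1)
| LA3 : listed (blk 1 0 0 1 1)
| LA4 : listed (blk t 0 0 1 1)
| LA5 : listed (mx3 0 (-1) 1 1 1 0 1 0 0)
| LA6 k : k != 0 -> listed (blk k 0 1 1 1)
| LB2 : listed (blk 1 0 1 0 0)
| LB3 : listed (blk t 0 1 0 0)
| LB4 : listed (blk 0 0 0 1 0)
| LB5 : listed (blk 1 0 0 1 0)
| LB6 : listed (mx3 0 (-1) 1 1 0 0 1 0 0)
| LB7 k : k != 0 -> listed (blk k 0 1 1 0)
| LC2 : listed (blk 1 0 0 0 0)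
| LD : listed (blk 0 0 0 0 0).

(** The diagonal change by [y^-1] and [y] has determinant 1, so it moves a square from one
    coefficient to the other without touching [m]. *)
Lemma blk_square a d m s y : y != 0 ->
  sim (blk (a * y ^+ 2) 0 d m s) (blk a 0 (d * y ^+ 2) m s).
Proof.
move=> y0; apply: (@sim3 1 y^-1 0 0 0 y 0 0 0 1); first exact: oner_neq0.
  by rewrite (_ : _ + _ = 1) ?oner_neq0 //; field.
by rewrite /blk !mx3s; congr mx3; field.
Qed.

(** Without skew part the determinant is free, and the square can simply be dropped. *)
Lemma blk_square0 a d s y : y != 0 ->
  sim (blk (a * y ^+ 2) 0 d 0 s) (blk a 0 d 0 s).
Proof.
move=> y0; apply: (@sim3 1 y^-1 0 0 0 1 0 0 0 1); first exact: oner_neq0.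
  by rewrite (_ : _ + _ = y^-1) ?invr_eq0 //; ring.
by rewrite /blk !mx3s; congr mx3; field.
Qed.

Lemma blk_listed a b d m s : exists2 B, sim (blk a b d m s) B & listed B.
Proof.
have [a1 [b1 [d1 [m1 [s1 [sB [hm hs]]]]]]] := blk_scale a b d m s.
have [a2 [d2 [sC had]]] := blk_diag a1 b1 d1 m1 s1.
suff [B sB' lB] : exists2 B, sim (blk a2 0 d2 m1 s1) B & listed B.
  by exists B => //; apply: sim_trans sB (sim_trans sC sB').
move: a2 d2 m1 s1 hm hs had {sB sC a b d m s a1 b1 d1} => a d m s hm hs had.
have sq0 (x y : F) : x != 0 -> x = y ^+ 2 \/ x = t * y ^+ 2 -> y != 0.
  by move=> x0 [] e; apply: contraNneq x0 => y0; rewrite e y0 expr0n ?mulr0.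
have two_block x : x != 0 -> exists2 B, sim (blk x 0 1 0 0) B & listed B.
  move=> x0; have [y hy] := square_classes x0; have y0 := sq0 _ _ x0 hy.
  case: hy => ->; [exists (blk 1 0 1 0 0) | exists (blk t 0 1 0 0)]; try by constructor.
    by rewrite -[y ^+ 2]mul1r; apply: blk_square0.
  exact: blk_square0.
have one_block x : x != 0 -> exists2 B, sim (blk x 0 0 0 0) B & listed B.
  move=> x0; exists (blk 1 0 0 0 0); last by constructor.
  apply: (@sim3 x^-1 1 0 0 0 1 0 0 0 1); first by rewrite invr_eq0.
    by rewrite (_ : _ + _ = 1) ?oner_neq0 //; ring.
  by rewrite /blk !mx3s; congr mx3; field.
(* Eight cases, ordered by [d], then [m], then [s], each 0 before 1; when [d] is 0 the coefficient
   [a] may vanish too. *)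
case: had => [->|[a0 ->]]; case: hm => ->; case: hs => ->.
- have [->|a0] := eqVneq a 0; last exact: one_block.
  by exists (blk 0 0 0 0 0); [exact: sim_refl | constructor].
- have [->|a0] := eqVneq a 0.
    have [B sB' lB] := one_block 1 (oner_neq0 _); exists B => //; apply: sim_trans sB'.
    apply: (@sim3 1 0 0 1 0 1 0 (-1) 0 0); first exact: oner_neq0.
      by rewrite (_ : _ + _ = 1) ?oner_neq0 //; ring.
    by rewrite /blk !mx3s; congr mx3; ring.
  have [B sB' lB] := two_block _ a0; exists B => //; apply: sim_trans sB'.
  apply: (@sim3 1 1 0 0 0 0 (-1) 0 1 0); first exact: oner_neq0.
    by rewrite (_ : _ + _ = 1) ?oner_neq0 //; ring.
  by rewrite /blk !mx3s; congr mx3; ring.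
- have [->|a0] := eqVneq a 0.
    by exists (blk 0 0 0 1 0); [exact: sim_refl | constructor].
  exists (blk 1 0 0 1 0); last by constructor.
  apply: (@sim3 a^-1 1 0 0 0 a 0 0 0 1); first by rewrite invr_eq0.
    by rewrite (_ : _ + _ = a) //; ring.
  by rewrite /blk !mx3s; congr mx3; field.
- have [->|a0] := eqVneq a 0.
    by exists (blk 0 0 0 1 1); [exact: sim_refl | constructor].
  have [y hy] := square_classes a0; have y0 := sq0 _ _ a0 hy.
  case: hy => ->; [exists (blk 1 0 0 1 1) | exists (blk t 0 0 1 1)]; try by constructor.
    by rewrite -[y ^+ 2]mul1r -[X in blk 1 _ X](mul0r (y ^+ 2)); apply: blk_square.
  by rewrite -[X in sim _ (blk _ _ X _ _)](mul0r (y ^+ 2)); apply: blk_square.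
- exact: two_block.
- exists (blk 1 0 1 0 1); last by constructor.
  (* Writing [a^-1] as a sum of two squares gives a similitude of the plane with that factor;
     scaling the whole form by [a] then brings all three coefficients to 1. *)
  have [x [y]] := universal a^-1 (oner_neq0 F); set q := _ + _ => xy.
  have -> : blk 1 0 1 0 1 = blk 1 0 (a * q) 0 (a * q) by rewrite xy mulfV.
  apply: (@sim3 a a^-1 0 0 0 x (- y) 0 y x) => //.
    rewrite (_ : _ + _ = a^-1 * q); last by rewrite /q; ring.
    by rewrite xy mulf_neq0 ?invr_eq0.
  by rewrite /blk !mx3s /q; congr mx3; field.
- by exists (blk a 0 1 1 0); [exact: sim_refl | constructor].
- by exists (blk a 0 1 1 1); [exact: sim_refl | constructor].
Qed.

Lemma basis_completion (v : 'cV[F]_3) : v != 0 -> exists2 Q, Q \in unitmx & col (2%:R) Q = v.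
Proof.
move=> v0; have [z0|z0] := eqVneq (v (2%:R) 0) 0; last first.
  exists (mx3 1 0 (v 0 0) 0 1 (v 1 0) 0 0 (v (2%:R) 0)).
    by rewrite unitmxE mx3_det unitfE (_ : _ + _ = v (2%:R) 0) //; ring.
  by apply/colP; apply: ord3P; rewrite !mxE.
have [y0|y0] := eqVneq (v 1 0) 0; last first.
  exists (mx3 1 0 (v 0 0) 0 0 (v 1 0) 0 1 (v (2%:R) 0)).
    by rewrite unitmxE mx3_det unitfE (_ : _ + _ = - v 1 0) ?oppr_eq0 //; ring.
  by apply/colP; apply: ord3P; rewrite !mxE.
have [x0|x0] := eqVneq (v 0 0) 0; last first.
  exists (mx3 0 0 (v 0 0) 1 0 (v 1 0) 0 1 (v (2%:R) 0)).
    by rewrite unitmxE mx3_det unitfE (_ : _ + _ = v 0 0) //; ring.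
  by apply/colP; apply: ord3P; rewrite !mxE.
by case/eqP: v0; apply/colP; apply: ord3P; rewrite mxE.
Qed.

Definition cv3 (x y z : F) : 'cV[F]_3 := \col_i nth 0 [:: x; y; z] i.

Lemma mx3_mulcv a b c d e f g h i x y z :
  mx3 a b c d e f g h i *m cv3 x y z =
  cv3 (a * x + b * y + c * z) (d * x + e * y + f * z) (g * x + h * y + i * z).
Proof. by apply/colP; apply: ord3P; rewrite !mxE big_ord3 !mxE. Qed.

Lemma cv3_eq0 x y z : (cv3 x y z == 0) = [&& x == 0, y == 0 & z == 0].
Proof.
apply/eqP/and3P => [/colP h|[/eqP-> /eqP-> /eqP->]].
  by have := h 0; have := h 1; have := h (2%:R); rewrite !mxE /= => -> -> ->; rewrite !eqxx.
by apply/colP; apply: ord3P; rewrite !mxE.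
Qed.

Definition quad A (v : 'cV[F]_3) := (v^T *m A *m v) 0 0.

Lemma quad_cv3 a b c d e f g h i x y z :
  quad (mx3 a b c d e f g h i) (cv3 x y z) =
  a * x ^+ 2 + e * y ^+ 2 + i * z ^+ 2 + (b + d) * x * y + (c + g) * x * z
    + (f + h) * y * z.
Proof. by rewrite /quad -mulmxA mx3_mulcv mxE big_ord3 !mxE /=; ring. Qed.

(** Polarization: when all basis vectors are isotropic, the sum of two of them has value twice an
    off-diagonal entry, and 2 is nonzero. *)
Lemma symmetric_nonisotropic A : A^T = A -> A != 0 -> exists2 v, v != 0 & quad A v != 0.
Proof.
rewrite {1 2}(mx3E A) mx3_tr => symA nzA.
have E i j : A i j = A j i.
  move: i j; do 2!apply: ord3P => //.
  all: have /matrixP e := symA.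
  - by have := e 0 1; rewrite !mxE.
  - by have := e 0 (2%:R); rewrite !mxE.
  - by have := e 0 1; rewrite !mxE.
  - by have := e 1 (2%:R); rewrite !mxE.
  - by have := e 0 (2%:R); rewrite !mxE.
  - by have := e 1 (2%:R); rewrite !mxE.
have q x y z : quad A (cv3 x y z) =  A 0 0 * x ^+ 2 + A 1 1 * y ^+ 2 + A (2%:R) (2%:R) * z ^+ 2
    + 2%:R * A 0 1 * x * y + 2%:R * A 0 (2%:R) * x * z + 2%:R * A 1 (2%:R) * y * z.
  rewrite (mx3E A) quad_cv3 !mxE /=; rewrite (E 1 0) (E (2%:R) 0) (E (2%:R) 1); ring.
have nz x y z : x != 0 \/ y != 0 \/ z != 0 -> cv3 x y z != 0.
  by rewrite cv3_eq0; case=> [|[]] /negPf->; rewrite ?andbF.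
have n1 : (1 : F) != 0 := oner_neq0 F.
have [a0|a0] := eqVneq (A 0 0) 0; last first.
  exists (cv3 1 0 0); first by apply: nz; left.
  by rewrite q (_ : _ + _ = A 0 0) //; ring.
have [b0|b0] := eqVneq (A 1 1) 0; last first.
  exists (cv3 0 1 0); first by apply: nz; right; left.
  by rewrite q (_ : _ + _ = A 1 1) //; ring.
have [c0|c0] := eqVneq (A (2%:R) (2%:R)) 0; last first.
  exists (cv3 0 0 1); first by apply: nz; right; right.
  by rewrite q (_ : _ + _ = A (2%:R) (2%:R)) //; ring.
have [d0|d0] := eqVneq (A 0 1) 0; last first.
  exists (cv3 1 1 0); first by apply: nz; left.
  by rewrite q a0 b0 (_ : _ + _ = 2%:R * A 0 1) ?mulf_neq0 //; ring.
have [e0|e0] := eqVneq (A 0 (2%:R)) 0; last first.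
  exists (cv3 1 0 1); first by apply: nz; left.
  by rewrite q a0 c0 (_ : _ + _ = 2%:R * A 0 (2%:R)) ?mulf_neq0 //; ring.
have [f0|f0] := eqVneq (A 1 (2%:R)) 0; last first.
  exists (cv3 0 1 1); first by apply: nz; right; left.
  by rewrite q b0 c0 (_ : _ + _ = 2%:R * A 1 (2%:R)) ?mulf_neq0 //; ring.
case/eqP: nzA; rewrite (mx3E A) (E 1 0) (E (2%:R) 0) (E (2%:R) 1) a0 b0 c0 d0 e0 f0.
by apply/matrixP; do 2!apply: ord3P; rewrite !mxE.
Qed.

(* The kernel of A - A^T is where A(v, -) and A(-, v) agree; a non-isotropic
   vector of it splits off. *)
Lemma sim_kernel_last A : exists a b c d f g s,
  sim A (mx3 a b f c d g f g s) /\ (b = c -> s != 0 \/ f = 0 /\ g = 0).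
Proof.
suff [v [v0 Av hv]] : exists v, [/\ v != 0, A *m v = A^T *m v &
    A^T = A -> A = 0 \/ quad A v != 0].
  have [Q uQ Qv] := basis_completion v0.
  pose B := Q^T *m A *m Q.
  have sAB : sim A B by exists 1, Q; rewrite oner_neq0 scale1r.
  have eB i : B i (2%:R) = B (2%:R) i.
    have: col (2%:R) B = col (2%:R) B^T.
      by rewrite /B !colE !trmx_mul trmxK -!mulmxA -colE Qv Av.
    by move/colP=> /(_ i); rewrite !mxE.
  have e22 : B (2%:R) (2%:R) = quad A v.
    have -> : quad A v = (delta_mx 0 (2%:R) *m B *m delta_mx (2%:R) 0 : 'M_1) 0 0.
      by rewrite /quad -Qv colE trmx_mul trmx_delta /B !mulmxA.
    by rewrite -rowE -colE [RHS]mxE [RHS]mxE.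
  exists (B 0 0), (B 0 1), (B 1 0), (B 1 1), (B (2%:R) 0), (B (2%:R) 1), (B (2%:R) (2%:R)).
  have BE := mx3E B; rewrite (eB 0) (eB 1) in BE.
  split; first by rewrite -BE.
  (* Symmetry of [B] passes back to [A], and in that case [v] was chosen non-isotropic unless [A] is
     zero. *)
  move=> b01; have symB : B^T = B by rewrite BE mx3_tr b01.
  have symA : A^T = A.
    have := congr1 (fun X => invmx Q^T *m X *m invmx Q) symB.
    rewrite /B !trmx_mul trmxK !mulmxA mulVmx ?unitmx_tr // mul1mx.
    by rewrite !mulmxK // mul1mx.
  case: (hv symA) => [A0|q0]; last by left; rewrite e22.
  by right; rewrite /B A0 mulmx0 mul0mx !mxE.
have [symA|nsymA] := eqVneq A^T A.
  have [A0|A0] := eqVneq A 0.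
    exists (cv3 1 0 0); rewrite cv3_eq0 oner_eq0 A0 trmx0; split=> //; by left.
  have [v v0 qv] := symmetric_nonisotropic symA A0.
  by exists v; rewrite symA; split=> //; right.
(* A skew matrix of order 3 kills the vector of its own entries. *)
exists (cv3 (A 1 (2%:R) - A (2%:R) 1) (A (2%:R) 0 - A 0 (2%:R)) (A 0 1 - A 1 0)); split.
- apply: contra nsymA; rewrite cv3_eq0 !subr_eq0 => /and3P[/eqP h1 /eqP h2 /eqP h3].
  by rewrite (mx3E A) mx3_tr h1 h2 h3.
- by rewrite {1 8}(mx3E A) mx3_tr !mx3_mulcv; congr cv3; ring.
- by move=> symA; rewrite symA eqxx in nsymA.
Qed.

Lemma mx3_blk a b c d s :
  mx3 a b 0 c d 0 0 0 s = blk a ((b + c) / 2%:R) d ((c - b) / 2%:R) s.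
Proof. by rewrite /blk; congr mx3; field. Qed.

(** The third basis vector spans the kernel of the skew part; it is isotropic but pairs with the
    first one to [f]. Clearing with it leaves only [m], [f] and one diagonal entry. *)
Lemma hyperbolic_listed a b c d f g : b != c -> f != 0 ->
  exists2 B, sim (mx3 a b f c d g f g 0) B & listed B.
Proof.
move=> bc f0; have cb0 : c - b != 0 by rewrite subr_eq0 eq_sym.
set m := (c - b) / 2%:R.
have m0 : m != 0 by rewrite mulf_neq0 ?invr_eq0.
(* A vanishing [d'] leads to the matrix of [B6], any other to that of [A5]. *)
suff [d' s1] : exists d', sim (mx3 a b f c d g f g 0) (mx3 0 (- m) f m d' 0 f 0 0).
  have [d0|d0] := eqVneq d' 0.
    exists (mx3 0 (-1) 1 1 0 0 1 0 0); last by constructor.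
    apply: sim_trans s1 _; rewrite d0.
    apply: (@sim3 1 m^-1 0 0 0 1 0 0 0 (m / f)); first exact: oner_neq0.
      by rewrite (_ : _ + _ = f^-1) ?invr_eq0 //; field; rewrite m0 f0.
    by rewrite !mx3s; congr mx3; field; rewrite ?m0 ?f0.
  exists (mx3 0 (-1) 1 1 1 0 1 0 0); last by constructor.
  apply: sim_trans s1 _.
  apply: (@sim3 d'^-1 (d' / m) 0 0 0 1 0 0 0 (m / f)); first by rewrite invr_eq0.
    by rewrite (_ : _ + _ = d' / f) ?mulf_neq0 ?invr_eq0 //; field; rewrite m0 f0.
  by rewrite !mx3s; congr mx3; field; rewrite ?m0 ?f0 ?d0.
(* Subtracting [g / f] times the first vector makes the second orthogonal to the third. *)
have s1 : sim (mx3 a b f c d g f g 0)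
    (mx3 a (b - a * (g / f)) f (c - a * (g / f))
       (d - (b + c) * (g / f) + a * (g / f) ^+ 2) 0 f 0 0).
  apply: (@sim3 1 1 (- (g / f)) 0 0 1 0 0 0 1); first exact: oner_neq0.
    by rewrite (_ : _ + _ = 1) ?oner_neq0 //; ring.
  by rewrite !mx3s; congr mx3; field.
(* Multiples of the third vector are added to the first two, to clear the first diagonal entry and
   the symmetric part of the entry beside it. *)
eexists; apply: sim_trans s1 _.
apply: (@sim3 1 1 0 0 0 1 0 (- (a / (2%:R * f)))
  (- ((b + c - 2%:R * a * (g / f)) / (2%:R * f))) 1); first exact: oner_neq0.
  by rewrite (_ : _ + _ = 1) ?oner_neq0 //; ring.
rewrite !mx3s; congr mx3; last first; try by field; rewrite ?two_neq0 ?f0.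
all: try by rewrite /m; field; rewrite ?two_neq0 ?f0.
Qed.

(** If [s] is nonzero the third vector splits off, and if [f] and [g] vanish it has already done so.
    Otherwise [b != c], and after a possible swap of the first two vectors the hyperbolic case
    applies. *)
Theorem sim_listed A : exists2 B, sim A B & listed B.
Proof.
have [a [b [c [d [f [g [s [sA hs]]]]]]]] := sim_kernel_last A.
suff [B sB lB] : exists2 B, sim (mx3 a b f c d g f g s) B & listed B.
  by exists B => //; apply: sim_trans sB.
have [s0|s0] := eqVneq s 0; last first.
  suff s1 : sim (mx3 a b f c d g f g s)
      (mx3 (a - f ^+ 2 / s) (b - f * g / s) 0 (c - f * g / s) (d - g ^+ 2 / s) 0 0 0 s).
    move: s1; rewrite mx3_blk; set X := blk _ _ _ _ _ => s1.
    have [B sB lB] : exists2 B, sim X B & listed B by apply: blk_listed.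
    by exists B => //; apply: sim_trans s1 sB.
  apply: (@sim3 1 1 0 0 0 1 0 (- (f / s)) (- (g / s)) 1); first exact: oner_neq0.
    by rewrite (_ : _ + _ = 1) ?oner_neq0 //; ring.
  by rewrite !mx3s; congr mx3; field.
have [fg|fg] := boolP ((f == 0) && (g == 0)).
  by case/andP: fg => /eqP-> /eqP->; rewrite mx3_blk; apply: blk_listed.
have bc : b != c.
  by apply: contra fg => /eqP /hs [|[-> ->]]; rewrite ?s0 eqxx.
rewrite s0; have [f0|f0] := eqVneq f 0; last exact: hyperbolic_listed.
have g0 : g != 0 by move: fg; rewrite f0 eqxx.
have [B sB lB] : exists2 B, sim (mx3 d c g b a f g f 0) B & listed B.
  by apply: hyperbolic_listed; rewrite // eq_sym.
exists B => //; apply: sim_trans sB.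
apply: (@sim3 1 0 1 0 1 0 0 0 0 1); first exact: oner_neq0.
  by rewrite (_ : _ + _ = -1) ?oppr_eq0 ?oner_neq0 //; ring.
by rewrite !mx3s; congr mx3; ring.
Qed.

(** * Invariants of congruence and scaling *)

Definition adj3 A : 'M[F]_3 :=
  let m i j k l := A i k * A j l - A i l * A j k in
  mx3 (m 1 (2%:R) 1 (2%:R)) (m 0 (2%:R) (2%:R) 1) (m 0 1 1 (2%:R))
      (m 1 (2%:R) (2%:R) 0) (m 0 (2%:R) 0 (2%:R)) (m 0 1 (2%:R) 0)
      (m 1 (2%:R) 0 1) (m 0 (2%:R) 1 0) (m 0 1 0 1).

Lemma adj3E a b c d e f g h i :
  adj3 (mx3 a b c d e f g h i) =
  mx3 (e * i - f * h) (c * h - b * i) (b * f - c * e)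
      (f * g - d * i) (a * i - c * g) (c * d - a * f)
      (d * h - e * g) (b * g - a * h) (a * e - b * d).
Proof. by rewrite /adj3 !mxE /=; congr mx3; ring. Qed.

Lemma adj3M A B : adj3 (A *m B) = adj3 B *m adj3 A.
Proof. by rewrite (mx3E A) (mx3E B) mx3_mul !adj3E mx3_mul; congr mx3; ring. Qed.

Lemma adj3T A : adj3 A^T = (adj3 A)^T.
Proof. by rewrite (mx3E A) mx3_tr !adj3E mx3_tr; congr mx3; ring. Qed.

Lemma adj3Z k A : adj3 (k *: A) = k ^+ 2 *: adj3 A.
Proof. by rewrite (mx3E A) mx3_scale !adj3E mx3_scale; congr mx3; ring. Qed.

Lemma mul_adj3 A : A *m adj3 A = (\det A)%:M.
Proof.
rewrite [in RHS](mx3E A) mx3_det [in LHS](mx3E A) adj3E mx3_mul.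
by apply/matrixP; do 2!apply: ord3P; rewrite !mxE /= ?mulr1n ?mulr0n; ring.
Qed.

Lemma adj3_unit A : A \in unitmx -> adj3 A \in unitmx.
Proof.
move=> uA; suff -> : adj3 A = \det A *: invmx A.
  by rewrite unitmxZ -?unitmxE // unitmx_inv.
by rewrite -(mulKmx uA (adj3 A)) mul_adj3 mul_mx_scalar.
Qed.

Lemma tr_scalemx m n c (X : 'M[F]_(m, n)) : (c *: X)^T = c *: X^T.
Proof. by apply/matrixP => i j; rewrite !mxE. Qed.

Definition symm A := A + A^T.

(* Spans the kernel of A - A^T, unless A is symmetric. *)
Definition skewv A :=
  cv3 (A 1 (2%:R) - A (2%:R) 1) (A (2%:R) 0 - A 0 (2%:R)) (A 0 1 - A 1 0).

Lemma symm_congr c Q A : symm (c *: (Q^T *m A *m Q)) = c *: (Q^T *m symm A *m Q).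
Proof.
by rewrite /symm tr_scalemx !trmx_mul trmxK mulmxDr mulmxDl scalerDr !mulmxA.
Qed.

(** A skew form on a 3-space corresponds to a vector through the cross product, and there a
    congruence acts by the adjugate. *)
Lemma skewv_congr c Q A : skewv (c *: (Q^T *m A *m Q)) = c *: (adj3 Q *m skewv A).
Proof.
rewrite (mx3E A) (mx3E Q) !mx3s adj3E /skewv !mxE /= mx3_mulcv.
by apply/colP; apply: ord3P; rewrite !mxE /=; ring.
Qed.

(** Six vanishing conditions stable under [sim]; they separate the labels up to parameters and
    square classes. *)
Definition sim_code A : seq bool :=
  [:: skewv A == 0; symm A == 0; adj3 (symm A) == 0; \det (symm A) == 0;
      quad (symm A) (skewv A) == 0; symm A *m skewv A == 0].

Lemma scale_unit_eq0 n c Q (R : 'M[F]_n) (X : 'M[F]_(3, n)) :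
  c != 0 -> Q \in unitmx -> R \in unitmx -> (c *: (Q *m X *m R) == 0) = (X == 0).
Proof.
move=> c0 uQ uR; rewrite scaler_eq0 (negPf c0) /=; apply/eqP/eqP => [|->].
  by move/(congr1 (fun Y => invmx Q *m Y *m invmx R)); rewrite !mulmxA mulVmx // mul1mx;
    rewrite mulmxK // mulmx0 mul0mx.
by rewrite mulmx0 mul0mx.
Qed.

(** As [Q *m adj3 Q] is the scalar [\det Q], the factor is the one of [det_symm_congr]; hence the
    ratio of the two quantities is invariant. *)
Lemma quad_congr c Q A : Q \in unitmx ->
  quad (symm (c *: (Q^T *m A *m Q))) (skewv (c *: (Q^T *m A *m Q))) =
  c ^+ 3 * \det Q ^+ 2 * quad (symm A) (skewv A).
Proof.
move=> uQ; rewrite symm_congr skewv_congr /quad tr_scalemx trmx_mul.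
have hQ : Q *m (adj3 Q *m skewv A) = \det Q *: skewv A.
  by rewrite mulmxA mul_adj3 mul_scalar_mx.
have hQt : (skewv A)^T *m (adj3 Q)^T *m Q^T = \det Q *: (skewv A)^T.
  by rewrite -mulmxA -trmx_mul mul_adj3 tr_scalar_mx mul_mx_scalar.
rewrite -!(scalemxAl, scalemxAr) !scalerA !mulmxA hQt -!mulmxA hQ.
by rewrite -!(scalemxAl, scalemxAr) !scalerA !mulmxA mxE; congr (_ * _); ring.
Qed.

Lemma det_symm_congr c Q A :
  \det (symm (c *: (Q^T *m A *m Q))) = c ^+ 3 * \det Q ^+ 2 * \det (symm A).
Proof. by rewrite symm_congr detZ !det_mulmx det_tr; ring. Qed.

Lemma adj3_symm_congr c Q A :
  adj3 (symm (c *: (Q^T *m A *m Q))) = c ^+ 2 *: (adj3 Q *m adj3 (symm A) *m (adj3 Q)^T).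
Proof. by rewrite symm_congr adj3Z !adj3M adj3T mulmxA. Qed.

Lemma sim_codeP A B : sim A B -> sim_code A = sim_code B.
Proof.
case=> c [Q [c0 uQ ->]]; rewrite /sim_code; set B' := c *: _.
have uR := adj3_unit uQ; have uQt : Q^T \in unitmx by rewrite unitmx_tr.
have uRt : (adj3 Q)^T \in unitmx by rewrite unitmx_tr.
have k0 : c ^+ 3 * \det Q ^+ 2 != 0.
  by rewrite mulf_neq0 ?expf_neq0 //; rewrite unitmxE unitfE in uQ.
have Sn : symm B' *m skewv B' = (c ^+ 2 * \det Q) *: (Q^T *m (symm A *m skewv A)).
  rewrite /B' symm_congr skewv_congr -!(scalemxAl, scalemxAr) scalerA.
  by rewrite -!mulmxA [Q *m (adj3 Q *m _)]mulmxA mul_adj3 mul_scalar_mx -!scalemxAr scalerA !mulmxA.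
rewrite Sn /B' det_symm_congr quad_congr // adj3_symm_congr symm_congr skewv_congr.
rewrite !scale_unit_eq0 ?expf_neq0 //.
rewrite !(mulrI_eq0 _ (mulfI k0)).
rewrite -[adj3 Q *m skewv A]mulmx1 -[Q^T *m (_ *m _)]mulmx1 !scale_unit_eq0 ?unitmx1 //.
by rewrite mulf_neq0 ?expf_neq0 //; rewrite unitmxE unitfE in uQ.
Qed.

Lemma sim_det_ratio k A B : sim A B ->
  \det (symm A) = k * quad (symm A) (skewv A) ->
  \det (symm B) = k * quad (symm B) (skewv B).
Proof.
by case=> c [Q [c0 uQ ->]] e; rewrite det_symm_congr quad_congr // e mulrCA.
Qed.

Lemma sim_adj_ratio k A B : sim A B ->
  adj3 (symm A) = k *: (skewv A *m (skewv A)^T) ->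
  adj3 (symm B) = k *: (skewv B *m (skewv B)^T).
Proof.
case=> c [Q [c0 uQ ->]] e; rewrite adj3_symm_congr skewv_congr e tr_scalemx trmx_mul.
by rewrite -!(scalemxAl, scalemxAr) !scalerA !mulmxA; congr (_ *: _); ring.
Qed.

(** For a symmetric part of rank 2 this records its discriminant up to squares: the scaling enters
    [adj3] squared and is absorbed by [v]. *)
Definition adj_square A := exists v : 'cV[F]_3, adj3 (symm A) = v *m v^T.

Lemma sim_adj_square A B : sim A B -> adj_square A -> adj_square B.
Proof.
case=> c [Q [c0 uQ ->]] [v e]; exists (c *: (adj3 Q *m v)).
rewrite adj3_symm_congr e tr_scalemx trmx_mul.
by rewrite -!(scalemxAl, scalemxAr) !scalerA !mulmxA.
Qed.

Lemma four_neq0 : 4%:R != 0 :> F.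
Proof. by rewrite (_ : 4%:R = 2%:R * 2%:R) ?mulf_neq0 //; ring. Qed.

Lemma eight_neq0 : 8%:R != 0 :> F.
Proof. by rewrite (_ : 8%:R = 2%:R * 4%:R) ?mulf_neq0 ?four_neq0 //; ring. Qed.

Lemma mx3_eq0 a b c d e f g h i :
  (mx3 a b c d e f g h i == 0 :> 'M[F]_3) =
  [&& a == 0, b == 0, c == 0, d == 0, e == 0, f == 0, g == 0, h == 0 & i == 0].
Proof.
apply/eqP/idP => [/matrixP z|].
  have := z 0 0; have := z 0 1; have := z 0 (2%:R); have := z 1 0; have := z 1 1.
  have := z 1 (2%:R); have := z (2%:R) 0; have := z (2%:R) 1; have := z (2%:R) (2%:R).
  by rewrite !mxE /= => -> -> -> -> -> -> -> -> ->; rewrite !eqxx.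
by do 8!case/andP=> /eqP->; move=> /eqP->; apply/matrixP; do 2!apply: ord3P; rewrite !mxE.
Qed.

Lemma symm_blk a b d m s : symm (blk a b d m s) = 2%:R *: blk a b d 0 s.
Proof. by rewrite /symm /blk mx3_tr mx3_add mx3_scale; congr mx3; ring. Qed.

Lemma skewv_blk a b d m s : skewv (blk a b d m s) = cv3 0 0 (- (2%:R * m)).
Proof. by rewrite /skewv !mxE /=; congr cv3; ring. Qed.

Lemma adj3_symm_blk a d m s :
  adj3 (symm (blk a 0 d m s)) = 4%:R *: blk (d * s) 0 (a * s) 0 (a * d).
Proof. by rewrite symm_blk adj3Z adj3E !mx3_scale; congr mx3; ring. Qed.

Lemma det_symm_blk a d m s : \det (symm (blk a 0 d m s)) = 8%:R * (a * d * s).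
Proof. by rewrite symm_blk mx3_scale mx3_det; ring. Qed.

Lemma quad_blk a d m s :
  quad (symm (blk a 0 d m s)) (skewv (blk a 0 d m s)) = 8%:R * (m ^+ 2 * s).
Proof. by rewrite symm_blk skewv_blk mx3_scale quad_cv3; ring. Qed.

Lemma sim_code_blk a d m s :
  sim_code (blk a 0 d m s) =
  [:: m == 0; [&& a == 0, d == 0 & s == 0]; [&& d * s == 0, a * s == 0 & a * d == 0];
      a * d * s == 0; m ^+ 2 * s == 0; m * s == 0].
Proof.
rewrite /sim_code adj3_symm_blk det_symm_blk quad_blk symm_blk skewv_blk.
rewrite /blk !mx3_scale mx3_mulcv !cv3_eq0 !mx3_eq0.
rewrite !(mulr0, mul0r, add0r, addr0, subrr, mulrN, oppr_eq0) !eqxx /=.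
rewrite !(mulrI_eq0 _ (mulfI two_neq0)) !(mulrI_eq0 _ (mulfI four_neq0)).
rewrite !(mulrI_eq0 _ (mulfI eight_neq0)).
rewrite [2%:R * s * _]mulrCA !mulrA -[_ * s * m]mulrA -[2%:R * 2%:R * _]mulrA.
by rewrite !(mulrI_eq0 _ (mulfI two_neq0)) [s * m]mulrC.
Qed.

Lemma sim_code_hyperbolic e :
  sim_code (mx3 0 (-1) 1 1 e 0 1 0 0) = [:: false; false; false; e == 0; true; false].
Proof.
rewrite /sim_code.
have -> : symm (mx3 0 (-1) 1 1 e 0 1 0 0) = mx3 0 0 2%:R 0 (2%:R * e) 0 2%:R 0 0.
  by rewrite /symm mx3_tr mx3_add; congr mx3; ring.
have -> : skewv (mx3 0 (-1) 1 1 e 0 1 0 0) = cv3 0 0 (- 2%:R).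
  by rewrite /skewv !mxE /=; congr cv3; ring.
have n2 := negPf two_neq0.
rewrite adj3E mx3_det quad_cv3 mx3_mulcv !cv3_eq0 !mx3_eq0.
rewrite !(mulr0, mul0r, add0r, addr0, subrr, sub0r, subr0, oppr0, mulrN, oppr_eq0, expr0n).
by rewrite !(mulf_eq0, n2, eqxx, andbF, orbF, andbT) /= ?n2 ?andbF ?orbF.
Qed.

(** The parameter is the ratio of the determinant of the symmetric part to its value at [skewv]. *)
Lemma sim_blk_det_ratio k k' : sim (blk k 0 1 1 1) (blk k' 0 1 1 1) -> k = k'.
Proof.
move=> s12; have := @sim_det_ratio k _ _ s12; rewrite !det_symm_blk !quad_blk => h.
have e : 8%:R * (k' * 1 * 1) = k * (8%:R * (1 ^+ 2 * 1)) by apply: h; ring.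
apply: (mulfI eight_neq0); transitivity (k * (8%:R * (1 ^+ 2 * 1))); first by ring.
by rewrite -e; ring.
Qed.

(** Determinant and value at [skewv] both vanish here; the parameter is recovered from the adjugate,
    which is [k] times the square of [skewv]. *)
Lemma sim_blk_adj_ratio k k' : sim (blk k 0 1 1 0) (blk k' 0 1 1 0) -> k = k'.
Proof.
move=> s12; have := @sim_adj_ratio k _ _ s12; rewrite !adj3_symm_blk !skewv_blk => h.
have cc x : cv3 0 0 x *m (cv3 0 0 x)^T = blk 0 0 0 0 (x ^+ 2).
  by apply/matrixP; do 2!apply: ord3P; rewrite !mxE big_ord1 !mxE /=; ring.
have: 4%:R *: blk (1 * 0) 0 (k * 0) 0 (k * 1) =
      k *: (cv3 0 0 (- (2%:R * 1)) *m (cv3 0 0 (- (2%:R * 1)))^T).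
  by rewrite cc !mx3_scale; congr mx3; ring.
move/h/matrixP/(_ (2%:R) (2%:R)); rewrite cc !mxE /= => e.
apply: (mulfI four_neq0); transitivity (k * (- (2%:R * 1)) ^+ 2); first by ring.
by rewrite -e; ring.
Qed.

Lemma square_quarter (x y : F) : x ^+ 2 = 4%:R * y -> y = (x / 2%:R) ^+ 2.
Proof. by move=> e; rewrite expr_div_n e; field; exact: four_neq0. Qed.

(** The adjugate has the single nonzero entry 4u, which must be a square. This tells [A3] from [A4];
    the next lemma tells [B2] from [B3] likewise. *)
Lemma sim_blk_square_skew u : sim (blk 1 0 0 1 1) (blk u 0 0 1 1) -> exists y, u = y ^+ 2.
Proof.
move=> /sim_adj_square h.
have [|v e] := h.
  exists (cv3 0 2%:R 0); rewrite adj3_symm_blk.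
  by apply/matrixP; do 2!apply: ord3P; rewrite !mxE big_ord1 !mxE /=; ring.
exists (v 1 0 / 2%:R); apply: square_quarter.
by move/matrixP/(_ 1 1): e; rewrite adj3_symm_blk !mxE big_ord1 !mxE /= mulr1 => ->; rewrite expr2.
Qed.

Lemma sim_blk_square_symm u : sim (blk 1 0 1 0 0) (blk u 0 1 0 0) -> exists y, u = y ^+ 2.
Proof.
move=> /sim_adj_square h.
have [|v e] := h.
  exists (cv3 0 0 2%:R); rewrite adj3_symm_blk.
  by apply/matrixP; do 2!apply: ord3P; rewrite !mxE big_ord1 !mxE /=; ring.
exists (v (2%:R) 0 / 2%:R); apply: square_quarter.
move/matrixP/(_ (2%:R) (2%:R)): e; rewrite adj3_symm_blk !mxE big_ord1 !mxE /= mulr1 => ->.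
by rewrite expr2.
Qed.
End Field.

End Matrices3.

(** * The classification over F_p *)

Section FiniteFieldSquares.

Import GRing.Theory.
Local Open Scope ring_scope.

Variable F : finFieldType.

Let sq := [set x ^+ 2 | x in [set~ (0 : F)]].

(** A chosen root and its negative, over all nonzero squares, cover the nonzero elements. *)
Let card_sq : (#|F|.-1 <= #|sq| + #|sq|)%N.
Proof.
pose r (y : F) := odflt 0 [pick x | x ^+ 2 == y].
have rP x : r (x ^+ 2) = x \/ r (x ^+ 2) = - x.
  rewrite /r; case: pickP => [z /= e|/(_ x)]; last by rewrite eqxx.
  by move: e; rewrite eqf_sqr => /orP[] /eqP ->; [left | right].
have -> : #|F|.-1 = #|[set~ (0 : F)]| by rewrite cardsC1.
have sub : [set~ (0 : F)] \subset (r @: sq) :|: ((fun y => - r y) @: sq).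
  apply/subsetP=> x nx; rewrite inE; apply/orP.
  have qx : x ^+ 2 \in sq by apply: imset_f.
  case: (rP x) => e; [left | right]; apply/imsetP; exists (x ^+ 2) => //.
  by rewrite e opprK.
apply: leq_trans (subset_leq_card sub) _.
by apply: leq_trans (leq_card_setU _ _) _; apply: leq_add; apply: leq_imset_card.
Qed.

(** The nonzero squares and their multiples by [t] are disjoint and each make up at least half of
    the nonzero elements, so no room is left for [x]. *)
Lemma nonsquare_class (t x : F) : (forall y, y ^+ 2 != t) -> x != 0 ->
  exists y, x = y ^+ 2 \/ x = t * y ^+ 2.
Proof.
move=> ht x0.
have t0 : t != 0 by have := ht 0; rewrite expr0n eq_sym.
have sq0 y : y \in sq -> y != 0.
  by case/imsetP=> z; rewrite !inE => z0 ->; rewrite expf_neq0.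
pose tsq := [set t * y | y in sq].
have ctsq : #|tsq| = #|sq| by rewrite card_imset //; apply: mulfI.
have dis : [disjoint sq & tsq].
  apply/pred0P=> z /=; apply/negP=> /andP[/imsetP[y _ ->]] /imsetP[_ /imsetP[w w0 ->] e].
  rewrite !inE in w0; have /eqP[] := ht (y / w).
  by rewrite expr_div_n e mulfK // expf_neq0.
case: (boolP (x \in sq :|: tsq)) => [|nx].
  rewrite inE => /orP[/imsetP[y _ ->]|/imsetP[_ /imsetP[y _ ->] ->]].
    by exists y; left.
  by exists y; right.
have sub : x |: (sq :|: tsq) \subset [set~ 0].
  apply/subsetP=> y; rewrite !inE => /or3P[/eqP->//|/sq0//|/imsetP[z /sq0 z0 ->]].
  by rewrite mulf_neq0.
have := subset_leq_card sub; rewrite cardsU1 nx cardsC1 cardsU disjoint_setI0 //.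
rewrite cards0 subn0 ctsq => /(leq_trans)/(_ card_sq).
by rewrite add1n ltnn.
Qed.

(** Pigeonhole: with 0 included, the squares are more than half of the field, so they meet the set
    of all [w - k * y ^+ 2]. *)
Lemma binary_form_universal (k w : F) : k != 0 -> exists x y, x ^+ 2 + k * y ^+ 2 = w.
Proof.
move=> k0.
have nq : 0 \notin sq.
  by apply/imsetP=> -[z]; rewrite !inE => z0 /esym/eqP; rewrite expf_eq0 (negPf z0).
pose q0 := 0 |: sq.
have q0P y : y \in q0 -> exists z, y = z ^+ 2.
  rewrite !inE => /orP[/eqP->|/imsetP[z _ ->]]; last by exists z.
  by exists 0; rewrite expr0n.
have cq : (#|F| < #|q0| + #|q0|)%N.
  rewrite /q0 cardsU1 nq !add1n addSn addnS ltnS.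
  have F0 : (0 < #|F|)%N by apply/card_gt0P; exists 0.
  by rewrite -(prednK F0) ltnS card_sq.
pose B := [set w - k * y | y in q0].
have cB : #|B| = #|q0|.
  by rewrite card_imset // => x y /addrI/oppr_inj/(mulfI k0).
case: (boolP [disjoint q0 & B]) => [dis|/pred0Pn[z /andP[/q0P[x ->] /imsetP[_ /q0P[y ->] e]]]].
  have := max_card (mem (q0 :|: B)); rewrite cardsU disjoint_setI0 // cards0 subn0 cB.
  by rewrite leqNgt cq.
by exists x, y; rewrite e subrK.
Qed.

End FiniteFieldSquares.

(** * The matrices of the labels *)

Section LabelMatrices.

Import GRing.Theory.
Local Open Scope ring_scope.

Variables (p : nat) (tau : int).
Hypotheses (p_pr : prime p) (p_odd : odd p).
Hypothesis tau_nonsq : forall x : 'F_p, x ^+ 2 != tau%:~R.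

Definition label_mx (l : label p) : 'M['F_p]_3 :=
  match l with
  | A1 => blk 1 0 1 0 1
  | A2 => blk 0 0 0 1 1
  | A3 => blk 1 0 0 1 1
  | A4 => blk tau%:~R 0 0 1 1
  | A5 => mx3 0 (-1) 1 1 1 0 1 0 0
  | A6 i => blk i.+1%:R 0 1 1 1
  | B1 => blk (-1) 0 1 1 1
  | B2 => blk 1 0 1 0 0
  | B3 => blk tau%:~R 0 1 0 0
  | B4 => blk 0 0 0 1 0
  | B5 => blk 1 0 0 1 0
  | B6 => mx3 0 (-1) 1 1 0 0 1 0 0
  | B7 i => blk i.+1%:R 0 1 1 0
  | C1 => blk (-1) 0 1 1 0
  | C2 => blk 1 0 0 0 0
  | D => blk 0 0 0 0 0
  end.

Lemma Fp_two_neq0 : 2%:R != 0 :> 'F_p.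
Proof.
rewrite -(dvdn_pcharf (pchar_Fp p_pr)) gtnNdvd //.
by case: p p_pr p_odd => [|[|[|]]].
Qed.

Lemma label_param_neq0 (i : 'I_(p - 2)) : i.+1%:R != 0 :> 'F_p.
Proof.
by rewrite -(dvdn_pcharf (pchar_Fp p_pr)) gtnNdvd //; have := ltn_ord i; lia.
Qed.

Lemma label_param_neqN1 (i : 'I_(p - 2)) : i.+1%:R != -1 :> 'F_p.
Proof.
rewrite -addr_eq0 natr1 -(dvdn_pcharf (pchar_Fp p_pr)) gtnNdvd //.
by have := ltn_ord i; lia.
Qed.

Lemma label_param_inj : injective (fun i : 'I_(p - 2) => i.+1%:R : 'F_p).
Proof.
move=> i j /(congr1 val); rewrite /= !val_Fp_nat // !modn_small; last 2 first.
- by have := ltn_ord j; lia.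
- by have := ltn_ord i; lia.
by case=> /val_inj.
Qed.

(** The values [i.+1] run through 1, ..., p - 2; the remaining nonzero value -1 belongs to [B1] and
    [C1]. *)
Lemma label_param_surj (k : 'F_p) : k != 0 -> k != -1 ->
  exists i : 'I_(p - 2), k = i.+1%:R.
Proof.
move=> k0 k1; have kp : (k < p)%N by have := ltn_ord k; rewrite [X in (_ < X)%N]Fp_cast.
have k0' : (0 < k)%N by rewrite lt0n; apply: contraNneq k0 => e; apply/eqP/val_inj.
have k1' : k.+1 != p.
  apply: contraNneq k1 => e; rewrite -addr_eq0 -[k]natr_Zp natr1 e.
  by rewrite pchar_Fp_0.
have lt : (k.-1 < p - 2)%N by move: k1' k0' kp => /eqP; lia.
by exists (Ordinal lt); rewrite /= prednK // natr_Zp.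
Qed.

Lemma label_mx_complete (A : 'M['F_p]_3) : exists l, sim A (label_mx l).
Proof.
have [B sAB lB] := sim_listed Fp_two_neq0 (@binary_form_universal _)
  (fun x => @nonsquare_class _ _ x tau_nonsq) A.
suff [l e] : exists l, B = label_mx l by exists l; rewrite -e.
case: {sAB} B / lB => [||||| k k0 |||||| k k0 ||].
- by exists A1.
- by exists A2.
- by exists A3.
- by exists A4.
- by exists A5.
- have [->|k1] := eqVneq k (-1); first by exists B1.
  by have [i ->] := label_param_surj k0 k1; exists (A6 i).
- by exists B2.
- by exists B3.
- by exists B4.
- by exists B5.
- by exists B6.
- have [->|k1] := eqVneq k (-1); first by exists C1.
  by have [i ->] := label_param_surj k0 k1; exists (B7 i).
- by exists C2.
- by exists D.
Qed.

Definition label_sim_code (l : label p) : seq bool :=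
  match l with
  | A1 => [:: true; false; false; false; true; true]
  | A2 => [:: false; false; true; true; false; false]
  | A3 | A4 => [:: false; false; false; true; false; false]
  | A5 => [:: false; false; false; false; true; false]
  | A6 _ | B1 => [:: false; false; false; false; false; false]
  | B2 | B3 => [:: true; false; false; true; true; true]
  | B4 => [:: false; true; true; true; true; true]
  | B5 => [:: false; false; true; true; true; true]
  | B6 => [:: false; false; false; true; true; false]
  | B7 _ | C1 => [:: false; false; false; true; true; true]
  | C2 => [:: true; false; true; true; true; true]
  | D => [:: true; true; true; true; true; true]
  end.

Lemma label_mx_code l : sim_code (label_mx l) = label_sim_code l.
Proof.
have t0 : tau%:~R != 0 :> 'F_p by have := tau_nonsq 0; rewrite expr0n eq_sym.
have hyp := sim_code_hyperbolic Fp_two_neq0.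
case: l => [|||||i|||||||i|||] /=; rewrite ?(sim_code_blk Fp_two_neq0) ?hyp;
  rewrite ?(mulr1, mul1r, mulr0, mul0r, expr1n, expr0n, oppr_eq0, eqxx, oner_eq0, andbF);
  rewrite ?(negPf t0) ?(negPf (label_param_neq0 _)) //.
Qed.

Lemma label_mx_inj l1 l2 : sim (label_mx l1) (label_mx l2) -> l1 = l2.
Proof.
have nsq y : tau%:~R <> y ^+ 2 :> 'F_p.
  by move=> e; have /eqP[] := tau_nonsq y.
have N1 (i : 'I_(p - 2)) : i.+1%:R <> -1 :> 'F_p by apply/eqP/label_param_neqN1.
have n2 := Fp_two_neq0.
move=> s12; have := sim_codeP s12; rewrite !label_mx_code.
(* Equal codes leave only the pairs inside [A3], [A4], inside [A6], [B1], inside [B2], [B3] and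
   inside [B7], [C1]. *)
case: l1 l2 s12 => [|||||i|||||||i|||] [|||||j|||||||j|||] //= s12 _.
- by case: (sim_blk_square_skew n2 s12) => y /nsq.
- by case: (sim_blk_square_skew n2 (sim_sym s12)) => y /nsq.
- by have /label_param_inj -> := sim_blk_det_ratio n2 s12.
- by have /N1 := sim_blk_det_ratio n2 s12.
- by have /esym/N1 := sim_blk_det_ratio n2 s12.
- by case: (sim_blk_square_symm n2 s12) => y /nsq.
- by case: (sim_blk_square_symm n2 (sim_sym s12)) => y /nsq.
- by have /label_param_inj -> := sim_blk_adj_ratio n2 s12.
- by have /N1 := sim_blk_adj_ratio n2 s12.
- by have /esym/N1 := sim_blk_adj_ratio n2 s12.
Qed.

(** In the parametrized families the determinant is [k + 1] times the last diagonal entry, so [B1]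
    drops out at -1. *)
Lemma label_mx_det l : (\det (label_mx l) != 0) = is_A l.
Proof.
have t0 : tau%:~R != 0 :> 'F_p by have := tau_nonsq 0; rewrite expr0n eq_sym.
case: l => [|||||i|||||||i|||] /=; rewrite ?mx3_det;
  rewrite ?(mulr1, mul1r, mulr0, mul0r, addr0, add0r, subr0, sub0r, mulrN, mulNr, opprK, subrr,
    oppr0, oppr_eq0, oner_eq0, eqxx) ?t0 //.
- by rewrite addr_eq0 label_param_neqN1.
- by rewrite addrC subrr eqxx.
Qed.

End LabelMatrices.

(** * The group attached to a matrix *)

Section CrossProduct.

Import GRing.Theory.
Local Open Scope ring_scope.

Variable R : comNzRingType.
Implicit Types x y z : 'rV[R]_3.

Definition rv3 (a b c : R) : 'rV[R]_3 := \row_i nth 0 [:: a; b; c] i.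

Definition crs x y : 'rV[R]_3 :=
  let m i j := x 0 i * y 0 j - x 0 j * y 0 i in rv3 (m 1 (2%:R)) (m (2%:R) 0) (m 0 1).

(* Collecting [a1^x1 a2^x2 a3^x3 * a1^y1 a2^y2 a3^y3] creates the commutators
   [~ a3, a2]^(x3 y2), [~ a3, a1]^(x3 y1) and [~ a2, a1]^(x2 y1). *)
Definition half_crs x y : 'rV[R]_3 :=
  rv3 (- (x 0 (2%:R) * y 0 1)) (x 0 (2%:R) * y 0 0) (- (x 0 1 * y 0 0)).

Lemma crsE x y : crs x y = half_crs x y - half_crs y x.
Proof. by apply/rowP; apply: ord3P; rewrite !mxE /=; ring. Qed.

Lemma half_crsDl x x' y : half_crs (x + x') y = half_crs x y + half_crs x' y.
Proof. by apply/rowP; apply: ord3P; rewrite !mxE /=; ring. Qed.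

Lemma half_crsDr x y y' : half_crs x (y + y') = half_crs x y + half_crs x y'.
Proof. by apply/rowP; apply: ord3P; rewrite !mxE /=; ring. Qed.

Lemma half_crsZl k x y : half_crs (k *: x) y = k *: half_crs x y.
Proof. by apply/rowP; apply: ord3P; rewrite !mxE /=; ring. Qed.

Lemma half_crsZr k x y : half_crs x (k *: y) = k *: half_crs x y.
Proof. by apply/rowP; apply: ord3P; rewrite !mxE /=; ring. Qed.

End CrossProduct.

(** The carrier is always the space of row vectors; [w] and the matrix appear in the type so that
    the group law can depend on them. *)
Definition twisted (R : finComNzRingType) (w : R) of (w * w = 0)%R & 'M[R]_3 : Type :=
  'rV[R]_3.

Section TwistedGroup.

Import GRing.Theory.
Local Open Scope ring_scope.

Variables (R : finComNzRingType) (w : R) (w2 : w * w = 0) (A : 'M[R]_3).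

Local Notation K := (twisted w2 A).

HB.instance Definition _ := Finite.copy K 'rV[R]_3.

Let wcocycle (x y : 'rV[R]_3) : 'rV[R]_3 := w *: (half_crs x y *m A).

Definition twisted_mul (x y : K) : K := (x : 'rV_3) + y + wcocycle x y.
Definition twisted_one : K := (0 : 'rV[R]_3).
Definition twisted_inv (x : K) : K := - (x : 'rV_3) + wcocycle x x.

Let wDl x x' y : wcocycle (x + x') y = wcocycle x y + wcocycle x' y.
Proof. by rewrite /wcocycle half_crsDl mulmxDl scalerDr. Qed.

Let wDr x y y' : wcocycle x (y + y') = wcocycle x y + wcocycle x y'.
Proof. by rewrite /wcocycle half_crsDr mulmxDl scalerDr. Qed.

Let wwl x y : wcocycle (w *: x) y = 0.
Proof. by rewrite /wcocycle half_crsZl -scalemxAl scalerA w2 scale0r. Qed.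

Let wwr x y : wcocycle x (w *: y) = 0.
Proof. by rewrite /wcocycle half_crsZr -scalemxAl scalerA w2 scale0r. Qed.

Let wZl k x y : wcocycle (k *: x) y = k *: wcocycle x y.
Proof. by rewrite /wcocycle half_crsZl -scalemxAl !scalerA mulrC. Qed.

Let wN x y : wcocycle (- x) y = - wcocycle x y.
Proof. by rewrite -scaleN1r wZl scaleN1r. Qed.

Let wcc x y z : wcocycle (wcocycle x y) z = 0. Proof. exact: wwl. Qed.
Let wcc' x y z : wcocycle z (wcocycle x y) = 0. Proof. exact: wwr. Qed.

(** A bilinear map is a cocycle, and since [w * w = 0] it vanishes as soon as one argument is itself
    a value of it. *)
Lemma twisted_mulA : associative twisted_mul.
Proof.
move=> x y z; rewrite /twisted_mul !wDl !wDr wcc wcc' !addr0.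
rewrite !addrA [in RHS](addrAC _ _ z).
by rewrite [in LHS](addrAC ((x : 'rV_3) + y + z)) [LHS]addrAC.
Qed.

Lemma twisted_mul1 : left_id twisted_one twisted_mul.
Proof.
move=> x; rewrite /twisted_mul /twisted_one add0r.
by rewrite -(scale0r (0 : 'rV_3)) wZl scale0r addr0.
Qed.

Lemma twisted_mulV : left_inverse twisted_one twisted_inv twisted_mul.
Proof.
move=> x; rewrite /twisted_mul /twisted_inv wDl wcc addr0 wN.
by rewrite addrAC addrK addNr.
Qed.

HB.instance Definition _ :=
  Finite_isGroup.Build K twisted_mulA twisted_mul1 twisted_mulV.

Lemma twistedM (x y : K) : (x * y)%g = x + y + w *: (half_crs x y *m A) :> 'rV_3.
Proof. by []. Qed.

Definition to_twisted (v : 'rV[R]_3) : K := v.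

Lemma twistedMr (x : K) v : (x * to_twisted (w *: v)%R)%g = x + w *: v :> 'rV_3.
Proof. by rewrite twistedM -/(wcocycle _ _) wwr addr0. Qed.

Lemma twistedX (x : K) n :
  (x ^+ n)%g = n%:R *: (x : 'rV_3) + ('C(n, 2)%:R * w) *: (half_crs x x *m A) :> 'rV_3.
Proof.
elim: n => [|n IHn]; first by rewrite expg0 bin0n mul0r !scale0r addr0.
set B := half_crs x x *m A in IHn *.
rewrite expgSr twistedM IHn -/(wcocycle _ _) wDl wZl -scalerA wZl wwl scaler0 addr0.
rewrite binS bin1 -natr1 natrD mulrDl !scalerDl scale1r !scalerA -!addrA.
by congr (_ + _); rewrite addrCA.
Qed.

(** Commutators antisymmetrize the cocycle, which turns [half_crs] into the full cross product. *)
Lemma twisted_comm (x y : K) : [~ x, y]%g = to_twisted (w *: (crs x y *m A)).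
Proof.
apply: (mulgI (y * x)%g); rewrite -commgC.
rewrite [RHS]twistedMr !twistedM crsE mulmxBl scalerBr -!addrA addrCA.
by congr (_ + (_ + _)); rewrite addrCA addrN addr0.
Qed.

End TwistedGroup.

(** * Reduction from Z/p^2 to F_p *)

Section Reduction.

Import GRing.Theory.
Local Open Scope ring_scope.

Variable p : nat.
Hypothesis p_pr : prime p.

Local Notation Zpp := 'Z_(p ^ 2).

Lemma pp_gt1 : (1 < p ^ 2)%N.
Proof. by rewrite -(exp1n 2) ltn_exp2r ?prime_gt1. Qed.

Lemma p_sqr0 : p%:R * p%:R = 0 :> Zpp.
Proof. by rewrite -natrM mulnn pchar_Zp // pp_gt1. Qed.

Definition red (x : Zpp) : 'F_p := (x : nat)%:R.
(** A section of [red] that is not additive; after multiplication by [p] the choice of lift no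
    longer matters, by [p_mul_red]. *)
Definition lift_Fp (a : 'F_p) : Zpp := (a : nat)%:R.

Lemma red_nat n : red n%:R = n%:R.
Proof.
rewrite /red val_Zp_nat ?pp_gt1 // [in RHS](divn_eq n (p ^ 2)) natrD natrM natrX.
by rewrite (pchar_Fp_0 p_pr) expr0n mulr0 add0r.
Qed.

Lemma redD x y : red (x + y) = red x + red y.
Proof. by rewrite -[x]natr_Zp -[y]natr_Zp -natrD !red_nat natrD. Qed.

Lemma redM x y : red (x * y) = red x * red y.
Proof. by rewrite -[x]natr_Zp -[y]natr_Zp -natrM !red_nat natrM. Qed.

Lemma red0 : red 0 = 0. Proof. exact: (red_nat 0). Qed.

Lemma redN x : red (- x) = - red x.
Proof. by apply: (addIr (red x)); rewrite -redD !addNr red0. Qed.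

Lemma liftK : cancel lift_Fp red.
Proof. by move=> a; rewrite /lift_Fp red_nat natr_Zp. Qed.

Lemma red_p : red p%:R = 0.
Proof. by rewrite red_nat (pchar_Fp_0 p_pr). Qed.

Lemma p_mul_eq0 x : (p%:R * x == 0) = (red x == 0).
Proof.
rewrite -[x]natr_Zp -natrM red_nat -(dvdn_pcharf (pchar_Fp p_pr)).
rewrite -val_eqE /= val_Zp_nat ?pp_gt1 // -/(dvdn _ _).
by move: (nat_of_ord x) => n; rewrite -mulnn dvdn_pmul2l // prime_gt0.
Qed.

Lemma p_mul_red x : p%:R * lift_Fp (red x) = p%:R * x.
Proof.
by apply/eqP; rewrite -subr_eq0 -mulrBr p_mul_eq0 redD redN liftK subrr.
Qed.

Lemma p_mul_inj x y : p%:R * x = p%:R * y -> red x = red y.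
Proof.
by move/eqP; rewrite -subr_eq0 -mulrBr p_mul_eq0 redD redN subr_eq0 => /eqP.
Qed.

End Reduction.

(* [pi] is the quotient map onto G / G^p = F_p^3 and [iota] identifies F_p^3 with
   G^p through the p-th power map. *)
Record coordinates (p : nat) (gT : finGroupType) (G : {group gT}) (A : 'M['F_p]_3)
    (pi : gT -> 'rV['F_p]_3) (iota : 'rV['F_p]_3 -> gT) : Prop := Coordinates {
  coord_card : #|G| = (p ^ 6)%N;
  coordM : {in G &, forall x y, pi (x * y) = (pi x + pi y)%R};
  coord_surj : forall v, exists2 x, x \in G & pi x = v;
  iota_morphD : forall u v, iota (u + v)%R = iota u * iota v;
  iota_inj : injective iota;
  iota_in : forall v, iota v \in G;
  coord_ker : forall x, x \in G -> pi x = 0%R -> exists v, x = iota v;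
  coordX : forall x, x \in G -> x ^+ p = iota (pi x);
  coordR : {in G &, forall x y, [~ x, y] = iota (crs (pi x) (pi y) *m A)%R}
}.

Definition has_coordinates p (gT : finGroupType) (G : {group gT}) A :=
  exists pi iota, @coordinates p gT G A pi iota.

(** * The model group on (Z/p^2)^3 and its coordinates *)

Section Model.

Import GRing.Theory.
Local Open Scope ring_scope.

Variable p : nat.
Hypotheses (p_pr : prime p) (p_odd : odd p).

Definition model (A : 'M['F_p]_3) : finGroupType :=
  twisted (p_sqr0 p_pr) (map_mx (@lift_Fp p) A).

Let red_mul (R := 'Z_(p ^ 2)) (v : 'rV[R]_3) (A : 'M['F_p]_3) :
  map_mx (@red p) (v *m map_mx (@lift_Fp p) A) = map_mx (@red p) v *m A.
Proof.
by apply/rowP=> j; rewrite !mxE !big_ord3 !mxE !redD // !redM // !liftK.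
Qed.

Let red_crs (x y : 'rV['Z_(p ^ 2)]_3) :
  map_mx (@red p) (crs x y) = crs (map_mx (@red p) x) (map_mx (@red p) y).
Proof.
by apply/rowP; apply: ord3P; rewrite !mxE /= redD // redN // !redM.
Qed.

Let iota_red (v : 'rV['Z_(p ^ 2)]_3) :
  p%:R *: map_mx (@lift_Fp p) (map_mx (@red p) v) = p%:R *: v.
Proof. by apply/rowP=> j; rewrite !mxE p_mul_red. Qed.

Lemma model_coordinates A : has_coordinates [set: model A]%G A.
Proof.
pose pi (x : model A) : 'rV['F_p]_3 := map_mx (@red p) (x : 'rV_3).
pose iota (v : 'rV['F_p]_3) : model A := p%:R *: map_mx (@lift_Fp p) v.
have redw (v : 'rV['Z_(p ^ 2)]_3) : map_mx (@red p) (p%:R *: v) = 0.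
  by apply/rowP=> j; rewrite !mxE redM // red_p // mul0r.
have redD' (u v : 'rV['Z_(p ^ 2)]_3) :
    map_mx (@red p) (u + v) = map_mx (@red p) u + map_mx (@red p) v.
  by apply/rowP=> j; rewrite !mxE redD.
exists pi, iota; split.
- rewrite cardsT card_mx mul1n card_ord Zp_cast ?pp_gt1 // -expnM; congr (p ^ _)%N.
- by move=> x y _ _; rewrite /pi twistedM !redD' redw addr0.
- move=> v; exists (map_mx (@lift_Fp p) v : model A); rewrite ?inE //.
  by apply/rowP=> j; rewrite !mxE liftK.
- move=> u v; rewrite /iota; apply: esym; rewrite [LHS]twistedMr -scalerDr.
  rewrite -[LHS]iota_red redD'; congr (_ *: map_mx _ (_ + _)).
    by apply/rowP=> j; rewrite !mxE liftK.
  by apply/rowP=> j; rewrite !mxE liftK.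
- move=> u v /rowP e; apply/rowP=> j; have := e j; rewrite !mxE => /(p_mul_inj p_pr).
  by rewrite !liftK.
- by move=> v; rewrite inE.
- move=> x _ /rowP x0.
  (* All entries of [x] are divisible by [p], and [y] consists of the quotients. *)
  pose y : 'rV['F_p]_3 := \row_j ((x : 'rV_3) 0%R j %/ p)%:R.
  exists y; apply/rowP=> j; have := x0 j; rewrite !mxE => /eqP.
  rewrite /red -(dvdn_pcharf (pchar_Fp p_pr)) => px.
  apply/esym; rewrite -[X in _ = X]natr_Zp -[in RHS](divnK px) mulnC natrM.
  rewrite -[LHS](p_mul_red p_pr) -[RHS](p_mul_red p_pr); congr (_ * lift_Fp _).
  by rewrite liftK // red_nat.
- move=> x _; rewrite /iota /pi [RHS]iota_red [LHS]twistedX.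
  (* The quadratic term of [twistedX] carries ['C(p, 2) * p], which vanishes modulo p^2 for odd
     [p]. *)
  have /dvdnP[k ->] := dvdp_bin2 p_pr p_odd.
  by rewrite natrM -mulrA p_sqr0 // mulr0 scale0r addr0.
- move=> x y _ _; rewrite twisted_comm /iota /pi -red_crs -red_mul.
  by rewrite iota_red.
Qed.

End Model.

(** * Collection of words, and isomorphism with the model *)

Lemma collect3 (gT : finGroupType) (a b c a' b' c' z1 z2 z3 : gT) :
    c * a' = a' * c * z1 -> c * b' = b' * c * z2 -> b * a' = a' * b * z3 ->
    [/\ commute z1 b', commute z1 c' & commute z2 c'] ->
    [/\ commute z3 b', commute z3 c, commute z3 c' & commute z3 (z2 * z1)] ->
  a * b * c * (a' * b' * c') = a * a' * (b * b') * (c * c') * (z2 * z1 * z3).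
Proof.
move=> e1 e2 e3 [z1b z1c z2c] [z3b z3c z3c' z3z].
have h1 : c * (a' * b' * c') = a' * b' * (c * c') * (z2 * z1).
  rewrite !mulgA e1 -(mulgA _ z1) z1b !mulgA -(mulgA a' c) e2 !mulgA.
  by rewrite -(mulgA _ z1) z1c !mulgA -(mulgA _ z2) z2c !mulgA.
move: h1; rewrite -!mulgA => ->; congr (a * _).
rewrite [b * _]mulgA e3 -!mulgA; congr (a' * (b * _)).
rewrite [LHS]mulgA z3b -mulgA; congr (b' * _).
rewrite [LHS]mulgA z3c -mulgA; congr (c * _).
rewrite [LHS]mulgA z3c' -mulgA; congr (c' * _).
by rewrite [LHS]z3z -mulgA.
Qed.

Lemma shuffle3 (gT : finGroupType) (a b c a' b' c' : gT) :
    commute a' b -> commute a' c -> commute b' c ->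
  a * a' * (b * b') * (c * c') = a * b * c * (a' * b' * c').
Proof.
move=> cab cac cbc; rewrite -!mulgA; congr (a * _).
rewrite [LHS]mulgA cab -mulgA; congr (b * _).
by rewrite (mulgA b') cbc -mulgA [LHS]mulgA cac -mulgA.
Qed.

Definition powers3 (gT : finGroupType) p (a1 a2 a3 : gT) (v : 'rV['F_p]_3) : gT :=
  a1 ^+ (p * v 0%R 0%R) * a2 ^+ (p * v 0%R 1%R) * a3 ^+ (p * v 0%R (2%:R)%R).

Definition frame p (gT : finGroupType) (G : {group gT}) (A : 'M['F_p]_3) (a1 a2 a3 : gT) :=
  [/\ <<[set a1; a2; a3]>> = G,
      [/\ a1 ^+ (p ^ 2) = 1, a2 ^+ (p ^ 2) = 1 & a3 ^+ (p ^ 2) = 1] &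
      [/\ [~ a2, a3] = powers3 a1 a2 a3 (row 0%R A),
          [~ a3, a1] = powers3 a1 a2 a3 (row 1%R A) &
          [~ a1, a2] = powers3 a1 a2 a3 (row (2%:R)%R A)]].

Section FrameIsomorphism.

Import GRing.Theory.

Variables (p : nat) (gT : finGroupType) (G : {group gT}).
Hypotheses (p_pr : prime p) (p_odd : odd p).
Variables (A : 'M['F_p]_3) (a1 a2 a3 : gT).
Hypotheses (powG : powerful p G) (cardG : #|G| = (p ^ 6)%N).
Hypothesis frA : frame G A a1 a2 a3.

Let Zexp (a : gT) (x : 'Z_(p ^ 2)) := a ^+ x.

Let Zexp_nat a n : a ^+ (p ^ 2) = 1 -> Zexp a n%:R%R = a ^+ n.
Proof. by move=> a1'; rewrite /Zexp val_Zp_nat ?pp_gt1 // expg_mod. Qed.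

Let ZexpD a x y : a ^+ (p ^ 2) = 1 -> Zexp a (x + y)%R = Zexp a x * Zexp a y.
Proof.
move=> a1'; rewrite -{1}[x]natr_Zp -{1}[y]natr_Zp -natrD Zexp_nat //.
by rewrite expgD.
Qed.

(** The normal form a1^x1 a2^x2 a3^x3, which will be the isomorphism from the model. *)
Let f (x : 'rV['Z_(p ^ 2)]_3) : gT :=
  Zexp a1 (x 0 0)%R * Zexp a2 (x 0 1)%R * Zexp a3 (x 0 (2%:R))%R.

Let e (x : 'rV['Z_(p ^ 2)]_3) : gT := f (p%:R *: x)%R.

Let o1 : a1 ^+ (p ^ 2) = 1. Proof. by case: frA => _ []. Qed.
Let o2 : a2 ^+ (p ^ 2) = 1. Proof. by case: frA => _ []. Qed.
Let o3 : a3 ^+ (p ^ 2) = 1. Proof. by case: frA => _ []. Qed.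

Let gens : [/\ a1 \in G, a2 \in G & a3 \in G].
Proof. by case: frA => <- _ _; split; rewrite mem_gen // !inE eqxx ?orbT. Qed.

Let struct := @powerful_gen_exp2 p p_pr p_odd gT G [set a1; a2; a3].

Let genP : [/\ 'Mho^1(G) = <<[set x ^+ p | x in [set a1; a2; a3]]>>, 'Mho^1('Mho^1(G)) = 1,
      G^`(1) \subset 'Mho^1(G), 'Mho^1(G) \subset 'C(G) &
      {in G &, {morph (fun x => x ^+ p) : x y / x * y}}].
Proof.
apply: struct => //; first by case: frA.
by move=> x; rewrite !inE -orbA => /or3P[] /eqP->.
Qed.

Let pG : p.-group G. Proof. by case: powG. Qed.

Let cen_exp x n y : x \in G -> y \in G -> commute (x ^+ (p * n)) y.
Proof.
move=> Gx Gy; case: genP => _ _ _ /subsetP cG _; rewrite expgM.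
apply: commute_sym; apply: commuteX; apply: commute_sym.
exact: (centP (cG _ (mho_exp pG Gx))).
Qed.

Let cen_comm x y z : x \in G -> y \in G -> z \in G -> commute [~ x, y] z.
Proof.
move=> Gx Gy Gz; case: genP => _ _ /subsetP sG /subsetP cG _.
by apply: (centP (cG _ (sG _ _))); rewrite // derg1 mem_commg.
Qed.

Let Zexp_p a (x : 'Z_(p ^ 2)) : a ^+ (p ^ 2) = 1 -> Zexp a (p%:R * x)%R = a ^+ (p * x).
Proof. by move=> a1'; rewrite -{1}[x]natr_Zp -natrM Zexp_nat. Qed.

Let eE x : e x = a1 ^+ (p * x 0%R 0%R) * a2 ^+ (p * x 0%R 1%R) * a3 ^+ (p * x 0%R (2%:R)%R).
Proof. by rewrite /e /f !mxE !Zexp_p. Qed.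

Let fG x : f x \in G.
Proof. by have [G1 G2 G3] := gens; rewrite !groupM ?groupX. Qed.

Let fDe x y : f (x + p%:R *: y)%R = f x * e y.
Proof.
have [G1 G2 G3] := gens.
have c i (a b : gT) : a ^+ (p ^ 2) = 1 -> a \in G -> b \in G -> commute (Zexp a (p%:R * y 0 i)%R) b.
  by move=> oa Ga Gb; rewrite Zexp_p //; apply: cen_exp.
rewrite /e /f !mxE !ZexpD //; by apply: shuffle3; apply: c => //; apply: groupX.
Qed.

Let eD x y : e (x + y)%R = e x * e y.
Proof. by rewrite /e scalerDr fDe. Qed.

Let e0 : e 0%R = 1.
Proof. by apply: (mulgI (e 0%R)); rewrite -eD addr0 mulg1. Qed.

Let eN x : e (- x)%R = (e x)^-1.
Proof. by apply: (mulIg (e x)); rewrite -eD addNr e0 mulVg. Qed.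

Let eZ (k : 'Z_(p ^ 2)) x : e (k *: x)%R = e x ^+ k.
Proof.
rewrite -{1}[k]natr_Zp; elim: (nat_of_ord k) => [|n IHn].
  by rewrite scale0r e0 expg0.
by rewrite -natr1 scalerDl scale1r eD IHn expgSr.
Qed.

Let e_lift v : e (map_mx (@lift_Fp p) v) = powers3 a1 a2 a3 v.
Proof.
have val_lift (a : 'F_p) : (lift_Fp a : nat) = a.
  rewrite /lift_Fp val_Zp_nat ?pp_gt1 // modn_small //.
  apply: leq_trans (ltn_ord a) _; rewrite [X in X <= _]Fp_cast //.
  by rewrite -{1}[p]expn1 leq_exp2l ?prime_gt1.
by rewrite eE !mxE !val_lift.
Qed.

(** Collecting the right-hand product creates powers of three central commutators; [half_crs]
    records their exponents and the rows of [A] their values. *)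
Let fM x y : f (x + y + p%:R *: (half_crs x y *m map_mx (@lift_Fp p) A))%R = f x * f y.
Proof.
have [G1 G2 G3] := gens; case: frA => _ _ [r0 r1 r2].
rewrite fDe; set B := map_mx _ A.
have rB i : row i B = map_mx (@lift_Fp p) (row i A) by apply/rowP=> j; rewrite !mxE.
have R a b (m n : 'Z_(p ^ 2)) : a \in G -> b \in G ->
    Zexp a m * Zexp b n = Zexp b n * Zexp a m * [~ a, b] ^+ (m * n)%N.
  by move=> Ga Gb; rewrite commgC commXXg //; apply/commute_sym/cen_comm; rewrite ?groupR.
have Z a b n u : a \in G -> b \in G -> u \in G -> commute ([~ a, b] ^+ n) u.
  by move=> Ga Gb Gu; apply/commute_sym/commuteX/commute_sym/cen_comm.
rewrite [RHS](collect3 _ (R _ _ _ _ G3 G1) (R _ _ _ _ G3 G2) (R _ _ _ _ G2 G1)); last 2 first.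
- by split; apply: Z => //; rewrite groupX.
- by split; apply: Z; rewrite ?groupM ?groupX ?groupR.
rewrite [X in X * e _]/f !mxE !ZexpD //; congr (_ * _).
(* The minus signs occur where the collected commutator is the inverse of one in the relations. *)
have -> : (half_crs x y *m B = - (x 0 (2%:R) *: (y 0 1 *: row 0 B))
   + x 0 (2%:R) *: (y 0 0 *: row 1 B) + - (x 0 1 *: (y 0 0 *: row (2%:R) B)))%R.
  by apply/rowP=> j; rewrite !mxE big_ord3 !mxE /= !mulrA !mulNr.
rewrite !eD !eN !eZ !rB !e_lift -r0 -r1 -r2 -!expgVn !invg_comm -!expgM.
by congr (_ ^+ _ * _ ^+ _ * _ ^+ _); rewrite mulnC.
Qed.

(** The image of [f] contains the generators, so [f] is onto [G]; both groups have order p^6, so it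
    is injective. *)
Lemma frame_isog : G \isog [set: model p_pr A].
Proof.
have fM' : {in [set: model p_pr A] &, {morph (f : model p_pr A -> gT) : x y / x * y}}.
  by move=> x y _ _; rewrite [(x * y)%g]twistedM; apply: fM.
pose g := Morphism fM'.
have eG : g @* [set: model p_pr A] = G.
  apply/eqP; rewrite eqEsubset; apply/andP; split.
    by apply/subsetP=> _ /morphimP[x _ _ ->]; apply: fG.
  case: frA => {1}<- _ _; rewrite gen_subG.
  have inT (x : model p_pr A) : x \in [set: model p_pr A] by rewrite inE.
  have gf (x : 'rV['Z_(p ^ 2)]_3) y : f x = y -> y \in g @* [set: model p_pr A].
    by move=> <-; rewrite morphimEdom; apply: (imset_f g (inT x)).
  have E a : Zexp a 0%R = 1 by [].
  have E1 a : Zexp a 1%R = a by rewrite /Zexp /= modn_small.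
  apply/subsetP=> z; rewrite !inE -orbA => /or3P[] /eqP->.
  - by apply: (gf (rv3 1 0 0)%R); rewrite /f !mxE /= !E E1 !mulg1.
  - by apply: (gf (rv3 0 1 0)%R); rewrite /f !mxE /= !E E1 mulg1 mul1g.
  - by apply: (gf (rv3 0 0 1)%R); rewrite /f !mxE /= !E E1 !mul1g.
rewrite isog_sym; apply/isogP; exists g => //.
have [pi [iota co]] := model_coordinates p_pr p_odd A.
by rewrite -card_im_injm eG cardG (coord_card co).
Qed.

End FrameIsomorphism.

(** * Ideals and base change *)

Section IdealsLinearAlgebra.

Import GRing.Theory.
Local Open Scope ring_scope.

Variable F : fieldType.

Lemma crs_eq0_sub (w t : 'rV[F]_3) : w != 0 -> crs w t = 0 -> (t <= w)%MS.
Proof.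
move=> w0 /rowP e; have e0 := e 0; have e1 := e 1; have e2 := e (2%:R).
rewrite !mxE /= in e0 e1 e2.
move/eqP: e0; move/eqP: e1; move/eqP: e2; rewrite !subr_eq0 => /eqP e2 /eqP e1 /eqP e0.
suff [k e'] : exists k, t = k *: w by rewrite e' scalemx_sub.
have [w00|w00] := eqVneq (w 0 0) 0; last first.
  exists (t 0 0 / w 0 0); apply/rowP; apply: ord3P; rewrite mxE; first by rewrite mulfVK.
    by apply: (mulfI w00); rewrite e2; field.
  by apply: (mulfI w00); rewrite -e1; field.
have [w01|w01] := eqVneq (w 0 1) 0; last first.
  exists (t 0 1 / w 0 1); apply/rowP; apply: ord3P; rewrite mxE ?mulfVK //.
    by apply: (mulfI w01); rewrite -e2; field.
  by apply: (mulfI w01); rewrite e0; field.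
have [w02|w02] := eqVneq (w 0 (2%:R)) 0; last first.
  exists (t 0 (2%:R) / w 0 (2%:R)); apply/rowP; apply: ord3P; rewrite mxE ?mulfVK //.
    by apply: (mulfI w02); rewrite e1; field.
  by apply: (mulfI w02); rewrite -e0; field.
by case/eqP: w0; apply/rowP; apply: ord3P; rewrite mxE.
Qed.

(** Cyclic symmetry of the triple product moves [x] out of the cross product; then [x] runs over the
    standard basis. *)
Lemma crs_orthogonal (v : 'rV[F]_3) (t : 'cV[F]_3) :
  (forall x, crs v x *m t = 0) -> crs v t^T = 0.
Proof.
move=> h; have hx a b c := congr1 (fun X : 'M_1 => X 0 0) (h (rv3 a b c)).
have h0 := hx 1 0 0; have h1 := hx 0 1 0; have h2 := hx 0 0 1.
rewrite !mxE !big_ord3 !mxE /= in h0 h1 h2.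
apply/rowP; apply: ord3P; rewrite !mxE /=.
- by rewrite -[RHS]oppr0 -h0; ring.
- by rewrite -[RHS]oppr0 -h1; ring.
- by rewrite -[RHS]oppr0 -h2; ring.
Qed.

(* If [u] annihilates the ideal then A u is proportional to every vector w of it,
   so the ideal is a line; but then A maps the plane orthogonal to it into a line. *)
Lemma ideal_full m (U : 'M[F]_(m, 3)) (A : 'M[F]_3) (w : 'rV[F]_3) :
    A \in unitmx -> w != 0 -> (w <= U)%MS ->
    (forall v x : 'rV[F]_3, (v <= U)%MS -> (crs v x *m A <= U)%MS) ->
  row_full U.
Proof.
move=> uA w0 wU hU.
have C (u : 'cV_3) (v : 'rV_3) : U *m u = 0 -> (v <= U)%MS -> crs v (A *m u)^T = 0.
  move=> Uu vU; apply: crs_orthogonal => x; rewrite mulmxA.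
  by have /submxP[d ->] := hU v x vU; rewrite -mulmxA Uu mulmx0.
have A0 (u : 'cV_3) : A *m u = 0 -> u = 0.
  by move=> e; rewrite -(mulKmx uA u) e mulmx0.
apply/idPn => nf.
have : kermx U^T != 0 by rewrite kermx_eq0 /row_free mxrank_tr.
rewrite -nz_row_eq0; set u' := nz_row _ => nu.
have /sub_kermxP u'U : (u' <= kermx U^T)%MS by apply: nz_row_sub.
have Uu : U *m u'^T = 0 by rewrite -[U]trmxK -trmx_mul u'U trmx0.
set t := (A *m u'^T)^T.
have t0 : t != 0.
  apply: contra nu => /eqP/(congr1 trmx); rewrite trmxK trmx0 => /A0/(congr1 trmx).
  by rewrite trmxK trmx0 => ->.
have Ut : (U <= t)%MS.
  apply/row_subP=> i; apply: crs_eq0_sub => //.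
  have := C _ _ Uu (row_sub i U); rewrite -/t => e.
  by rewrite crsE -[RHS]oppr0 -e crsE opprB.
have tw : (t <= w)%MS by apply: crs_eq0_sub => //; apply: C.
have Uw := submx_trans Ut tw.
have : (kermx w^T *m A^T <= w)%MS.
  apply/row_subP=> i; rewrite row_mul.
  apply: crs_eq0_sub => //.
  have -> : row i (kermx w^T) *m A^T = (A *m (row i (kermx w^T))^T)^T.
    by rewrite trmx_mul trmxK.
  apply: C => //; case/submxP: Uw => d ->; rewrite -mulmxA.
  suff -> : w *m (row i (kermx w^T))^T = 0 by rewrite mulmx0.
  by rewrite -{1}[w]trmxK -trmx_mul -row_mul mulmx_ker row0 trmx0.
(* The plane orthogonal to [w] keeps its rank 2 under the invertible [A], yet lands in a line. *)
move/mxrankS; rewrite mxrankMfree; last by rewrite row_free_unit unitmx_tr.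
by rewrite mxrank_ker mxrank_tr (rank_rV w) w0.
Qed.

(** A nonzero column killed by [A] has as its annihilator a plane containing the row space of [A].
    Such a plane is an ideal, since every product with [A] falls into it. *)
Lemma singular_ideal (A : 'M[F]_3) : A \notin unitmx ->
  exists2 M : 'M[F]_(2, 3), row_free M & (A <= M)%MS.
Proof.
rewrite -row_free_unit => nA.
have : kermx A^T != 0 by rewrite kermx_eq0 /row_free mxrank_tr.
rewrite -nz_row_eq0; set u := nz_row _ => nu.
have /sub_kermxP uA : (u <= kermx A^T)%MS by apply: nz_row_sub.
have Au : A *m u^T = 0 by rewrite -[A]trmxK -trmx_mul uA trmx0.
have rk : \rank (kermx u^T) = 2 by rewrite mxrank_ker mxrank_tr rank_rV nu.
have [M fM MK] : exists2 M : 'M[F]_(\rank (kermx u^T), 3),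
    row_free M & (M :=: kermx u^T)%MS.
  by exists (row_base (kermx u^T)); [apply: row_base_free | apply: eq_row_base].
move: M fM MK; rewrite rk => M fM MK; exists M => //.
by rewrite MK; apply/sub_kermxP.
Qed.

(** The rows of the cofactor matrix [(adj3 P)^T] are the cross products of the rows of [P]. *)
Lemma adj3_crs (P A B : 'M[F]_3) :
  [/\ crs (row 1 P) (row (2%:R) P) *m A = row 0 B *m P,
      crs (row (2%:R) P) (row 0 P) *m A = row 1 B *m P &
      crs (row 0 P) (row 1 P) *m A = row (2%:R) B *m P] <->
  (adj3 P)^T *m A = B *m P.
Proof.
have e0 : crs (row 1 P) (row (2%:R) P) = row 0 (adj3 P)^T.
  by apply/rowP; apply: ord3P; rewrite !mxE /=; ring.
have e1 : crs (row (2%:R) P) (row 0 P) = row 1 (adj3 P)^T.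
  by apply/rowP; apply: ord3P; rewrite !mxE /=; ring.
have e2 : crs (row 0 P) (row 1 P) = row (2%:R) (adj3 P)^T.
  by apply/rowP; apply: ord3P; rewrite !mxE /=; ring.
rewrite e0 e1 e2 -!row_mul; split=> [[h0 h1 h2]|-> //].
by apply/row_matrixP; apply: ord3P.
Qed.

(** Multiplying by [P^T] turns the cofactor equation into det(P) A = P^T B P, a congruence up to a
    scalar. *)
Lemma base_change_sim (A B : 'M[F]_3) :
  sim A B <-> exists2 P, P \in unitmx & (adj3 P)^T *m A = B *m P.
Proof.
have adjP (P : 'M[F]_3) : P^T *m (adj3 P)^T = (\det P)%:M.
  by rewrite -adj3T mul_adj3 det_tr.
split=> [/sim_sym[c [Q [c0 uQ eA]]] | [P uP eP]]; last first.
  apply: sim_sym; exists (\det P)^-1, P.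
  have d0 : \det P != 0 by move: uP; rewrite unitmxE unitfE.
  rewrite invr_eq0; split=> //.
  by rewrite -mulmxA -eP mulmxA adjP mul_scalar_mx scalerA mulVf // scale1r.
have d0 : \det Q != 0 by move: uQ; rewrite unitmxE unitfE.
(* Rescaling [Q] by [k] multiplies its determinant by k^3 but the congruence by k^2; this [k]
   balances the two sides. *)
pose k := (c * \det Q)^-1.
have k0 : k != 0 by rewrite invr_eq0 mulf_neq0.
have uP : k *: Q \in unitmx by rewrite unitmxZ // unitfE.
have uPt : (k *: Q)^T \in unitmx by rewrite unitmx_tr.
exists (k *: Q) => //; apply: (can_inj (mulKmx uPt)).
rewrite mulmxA adjP mul_scalar_mx detZ eA tr_scalemx.
rewrite -!(scalemxAl, scalemxAr) !scalerA mulmxA; congr (_ *: _).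
by rewrite /k; field; rewrite c0 d0.
Qed.

End IdealsLinearAlgebra.

(** * Groups with coordinates *)

Lemma coordinates_isog p (gT rT : finGroupType) (G : {group gT}) (H : {group rT}) A :
  G \isog H -> has_coordinates H A -> @has_coordinates p gT G A.
Proof.
case/isogP=> f injf fG [pi [iota co]].
have fH x : x \in G -> f x \in H by move=> Gx; rewrite -fG mem_morphim.
have gP v : invm injf (iota v) \in G /\ f (invm injf (iota v)) = iota v.
  have : iota v \in f @* G by rewrite fG (iota_in co).
  by case/morphimP=> x _ Gx ->; rewrite invmE.
exists (pi \o f), (invm injf \o iota); split=> /=.
- by rewrite -(card_injm injf (subxx G)) fG (coord_card co).
- by move=> x y Gx Gy; rewrite /= morphM // (coordM co) ?fH.
- move=> v; have [y] := coord_surj co v; rewrite -fG => /morphimP[x _ Gx ->] e.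
  by exists x.
- by move=> u v; rewrite (iota_morphD co) morphM // fG (iota_in co).
- move=> u v e; apply: (iota_inj co); have [_ <-] := gP u; have [_ <-] := gP v.
  by congr (f _).
- by move=> v; have [] := gP v.
- move=> x Gx /(coord_ker co (fH _ Gx))[v e]; exists v.
  by rewrite -e invmE.
- by move=> x Gx; rewrite -(coordX co (fH _ Gx)) -morphX // invmE ?groupX.
- by move=> x y Gx Gy; rewrite -(coordR co) ?fH // -morphR // invmE ?groupR.
Qed.

Section CoordinateTheory.

Import GRing.Theory.

Variables (p : nat) (gT : finGroupType) (G : {group gT}).
Hypotheses (p_pr : prime p) (p_odd : odd p).
Variables (A : 'M['F_p]_3) (pi : gT -> 'rV['F_p]_3) (iota : 'rV['F_p]_3 -> gT).
Hypothesis co : coordinates G A pi iota.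

Lemma coord1 : pi 1 = 0%R.
Proof. by apply: (addrI (pi 1)); rewrite -(coordM co) ?group1 // mulg1 addr0. Qed.

Lemma coordV x : x \in G -> pi x^-1 = (- pi x)%R.
Proof.
by move=> Gx; apply: (addIr (pi x)); rewrite -(coordM co) ?groupV // mulVg coord1 addNr.
Qed.

Lemma coord_exp x n : x \in G -> pi (x ^+ n) = (n%:R *: pi x)%R.
Proof.
move=> Gx; elim: n => [|n IHn]; first by rewrite expg0 coord1 scale0r.
by rewrite expgSr (coordM co) ?groupX // IHn -natr1 scalerDl scale1r.
Qed.

Lemma iota0 : iota 0%R = 1.
Proof. by apply: (mulgI (iota 0%R)); rewrite -(iota_morphD co) addr0 mulg1. Qed.

Lemma iotaX v n : iota v ^+ n = iota (n%:R *: v)%R.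
Proof.
elim: n => [|n IHn]; first by rewrite expg0 scale0r iota0.
by rewrite expgSr IHn -(iota_morphD co) -natr1 scalerDl scale1r.
Qed.

Lemma coord_iota v : pi (iota v) = 0%R.
Proof.
(* Any [iota v] is a p-th power, and [pi] takes values in a space of characteristic [p]. *)
have [x Gx <-] := coord_surj co v; rewrite -(coordX co Gx) coord_exp //.
by rewrite pchar_Fp_0 // scale0r.
Qed.

Lemma iota_central v x : x \in G -> commute (iota v) x.
Proof.
move=> Gx; apply/commgP; rewrite (coordR co) ?(iota_in co) // coord_iota.
suff -> : crs (0%R : 'rV['F_p]_3) (pi x) = 0%R by rewrite mul0mx iota0.
by apply/rowP; apply: ord3P; rewrite !mxE !mul0r subrr.
Qed.

Lemma coord_pgroup : p.-group G.
Proof. by rewrite /pgroup (coord_card co) pnatX pnat_id. Qed.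

Lemma coord_powerful : powerful p G.
Proof.
split; first exact: coord_pgroup.
rewrite gen_subG; apply/subsetP=> _ /imset2P[x y Gx Gy ->].
rewrite (coordR co) //; set v := mulmx _ _; have [z Gz <-] := coord_surj co v.
by rewrite -(coordX co Gz); apply/mem_gen/imset_f.
Qed.

Lemma coord_exp_p2 x : x \in G -> x ^+ (p ^ 2) = 1.
Proof.
move=> Gx; rewrite -mulnn expgM (coordX co Gx) iotaX pchar_Fp_0 //.
by rewrite scale0r iota0.
Qed.

Lemma coord_order x : x \in G -> pi x != 0%R -> #[x] = (p ^ 2)%N.
Proof.
move=> Gx nx; have : #[x] %| p ^ 2 by rewrite order_dvdn coord_exp_p2.
case/(dvdn_pfactor _ _ p_pr)=> m le_m e; rewrite e; congr (p ^ _)%N.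
apply/eqP; rewrite eqn_leq le_m ltnNge; apply: contra nx => m1.
have : #[x] %| p by rewrite e -{2}[p]expn1 dvdn_exp2l.
rewrite order_dvdn (coordX co Gx) => /eqP ix.
by apply/eqP/(iota_inj co); rewrite iota0.
Qed.

Lemma coord_eq x y : x \in G -> y \in G -> pi x = pi y -> exists v, x = y * iota v.
Proof.
move=> Gx Gy e; have [|v ev] := coord_ker co (groupM (groupVr Gy) Gx).
  by rewrite (coordM co) ?groupV // coordV // e addNr.
by exists v; rewrite -ev mulKVg.
Qed.

Lemma powers3_iota a1 a2 a3 v : a1 \in G -> a2 \in G -> a3 \in G ->
  powers3 a1 a2 a3 v =
  iota (v 0 0 *: pi a1 + v 0 1 *: pi a2 + v 0 (2%:R) *: pi a3)%R.
Proof.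
move=> G1 G2 G3; rewrite /powers3 !expgM !(coordX co) // !iotaX !natr_Zp.
by rewrite -!(iota_morphD co).
Qed.

Lemma scale_row3 (v : 'rV['F_p]_3) (P : 'M['F_p]_3) :
  (v *m P = v 0 0 *: row 0 P + v 0 1 *: row 1 P + v 0 (2%:R) *: row (2%:R) P)%R.
Proof. by rewrite mulmx_sum_row big_ord3. Qed.

(** A subgroup that maps onto all of F_p^3 contains every [iota v], as a p-th power, and so the
    whole kernel of [pi]. *)
Lemma coord_gen (S : {set gT}) : S \subset G ->
  (forall v, exists2 x, x \in <<S>> & pi x = v) -> <<S>> = G.
Proof.
move=> sSG hS; apply/eqP; rewrite eqEsubset gen_subG sSG; apply/subsetP=> x Gx.
have sSG' : <<S>> \subset G by rewrite gen_subG.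
have [y Sy yx] := hS (pi x); have Gy := subsetP sSG' _ Sy.
have [v ->] := coord_eq Gx Gy (esym yx); rewrite groupM //.
have [z Sz <-] := hS v; rewrite -(coordX co) ?groupX //.
exact: (subsetP sSG').
Qed.

Let Mof a1 a2 a3 : 'M['F_p]_3 :=
  (\matrix_(i < 3) pi (nth 1%g [:: a1; a2; a3] i))%R.

(** With the coordinates of the three generators as the rows of P, the relations read cof(P) A = B
    P, and generating [G] amounts to P being invertible. *)
Lemma frame_sim B : (exists a1 a2 a3, frame G B a1 a2 a3) <-> sim A B.
Proof.
rewrite base_change_sim.
have rels a1 a2 a3 : a1 \in G -> a2 \in G -> a3 \in G ->
  ([/\ [~ a2, a3] = powers3 a1 a2 a3 (row 0 B)%R,
       [~ a3, a1] = powers3 a1 a2 a3 (row 1 B)%R &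
       [~ a1, a2] = powers3 a1 a2 a3 (row (2%:R) B)%R] <->
   ((adj3 (Mof a1 a2 a3))^T *m A = B *m Mof a1 a2 a3)%R).
  move=> G1 G2 G3; rewrite -adj3_crs; set P := Mof _ _ _.
  have r0 : row 0%R P = pi a1 by rewrite rowK.
  have r1 : row 1%R P = pi a2 by rewrite rowK.
  have r2 : row (2%:R)%R P = pi a3 by rewrite rowK.
  rewrite !powers3_iota // -r0 -r1 -r2 -!scale_row3 r0 r1 r2 !(coordR co) //.
  by split=> -[h0 h1 h2]; split; do ?[exact: (iota_inj co) | congr (iota _)].
split=> [[a1 [a2 [a3 [defG _ rel]]]] | [P uP eP]].
  have [G1 G2 G3] : [/\ a1 \in G, a2 \in G & a3 \in G].
    by rewrite -defG; split; rewrite mem_gen // !inE eqxx ?orbT.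
  exists (Mof a1 a2 a3); last by apply/rels.
  rewrite -row_full_unit -[row_full _]negbK; apply/negP=> nf.
  have : kermx (Mof a1 a2 a3)^T != 0%R by rewrite kermx_eq0 /row_free mxrank_tr.
  rewrite -nz_row_eq0; set u := nz_row _ => nu.
  have /sub_kermxP uM : (u <= kermx (Mof a1 a2 a3)^T)%MS by apply: nz_row_sub.
  have Mu : (Mof a1 a2 a3 *m u^T = 0)%R by rewrite -[Mof _ _ _]trmxK -trmx_mul uM trmx0.
  (* A functional vanishing on the coordinates of the generators defines a subgroup containing them,
     hence all of [G]; the functional is then zero. *)
  pose K := [set x in G | pi x *m u^T == 0]%R.
  have gK : group_set K.
    apply/group_setP; split; first by rewrite inE group1 coord1 mul0mx eqxx.
    move=> x y; rewrite !inE => /andP[Gx /eqP ex] /andP[Gy /eqP ey].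
    by rewrite groupM // (coordM co) // mulmxDl ex ey addr0 eqxx.
  have sGK : G \subset Group gK.
    have rM i : (row i (Mof a1 a2 a3) *m u^T = 0)%R by rewrite -row_mul Mu row0.
    have := rM 0%R; have := rM 1%R; have := rM (2%:R)%R; rewrite !rowK /= => r2 r1 r0.
    suff : <<[set a1; a2; a3]>> \subset Group gK by rewrite defG.
    rewrite gen_subG; apply/subsetP=> x; rewrite !inE -orbA => /or3P[] /eqP->.
    - by rewrite G1 r0 eqxx.
    - by rewrite G2 r1 eqxx.
    - by rewrite G3 r2 eqxx.
  case/eqP: nu; apply: trmx_inj; rewrite trmx0 -[LHS]mul1mx.
  apply/row_matrixP=> i; rewrite row_mul row0.
  have [x Gx <-] := coord_surj co (row i 1%:M)%R.
  by have := subsetP sGK x Gx; rewrite !inE => /andP[_ /eqP].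
have [a1 G1 e1] := coord_surj co (row 0 P)%R.
have [a2 G2 e2] := coord_surj co (row 1 P)%R.
have [a3 G3 e3] := coord_surj co (row (2%:R) P)%R.
have MP : Mof a1 a2 a3 = P.
  by apply/row_matrixP; apply: ord3P; rewrite rowK.
exists a1, a2, a3; split; last by apply/rels; rewrite // MP.
  apply: coord_gen => [|v].
    by apply/subsetP=> x; rewrite !inE -orbA => /or3P[] /eqP->.
  pose c := (v *m invmx P)%R.
  exists (a1 ^+ c 0%R 0%R * a2 ^+ c 0%R 1%R * a3 ^+ c 0%R (2%:R)%R).
    by rewrite !groupM // groupX // mem_gen // !inE eqxx ?orbT.
  rewrite !(coordM co) ?groupM ?groupX // !coord_exp // !natr_Zp e1 e2 e3.
  by rewrite -scale_row3 mulmxKV.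
by rewrite !coord_exp_p2.
Qed.

Lemma coord_type_twos : type_twos p 3 G.
Proof.
have [a1 G1 e1] := coord_surj co (row 0 1%:M)%R.
have [a2 G2 e2] := coord_surj co (row 1 1%:M)%R.
have [a3 G3 e3] := coord_surj co (row (2%:R) 1%:M)%R.
have ord a i : a \in G -> pi a = row i 1%:M%R -> #[a] = (p ^ 2)%N.
  move=> Ga ea; apply: coord_order; rewrite // ea; apply/eqP=> /rowP/(_ i).
  by rewrite !mxE eqxx => /eqP; rewrite oner_eq0.
have o1 := ord _ _ G1 e1; have o2 := ord _ _ G2 e2; have o3 := ord _ _ G3 e3.
split; first exact: coord_powerful.
exists [tuple a1; a2; a3]; last first.
  by move=> a; rewrite !inE => /or3P[] /eqP->.
split; last by rewrite !big_cons big_nil o1 o2 o3 (coord_card co) muln1 -!expnD.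
rewrite !big_cons big_nil mulg1; apply/eqP; rewrite eqEsubset; apply/andP; split; last first.
  by rewrite !mul_subG // cycle_subG.
apply/subsetP=> x Gx; pose v := pi x.
pose y := a1 ^+ v 0%R 0%R * a2 ^+ v 0%R 1%R * a3 ^+ v 0%R (2%:R)%R.
have Gy : y \in G by rewrite !groupM ?groupX.
have [|u ->] := coord_eq Gx Gy.
  rewrite !(coordM co) ?groupM ?groupX // !coord_exp // !natr_Zp e1 e2 e3.
  by rewrite -scale_row3 mulmx1.
have -> : iota u = powers3 a1 a2 a3 u.
  by rewrite powers3_iota // e1 e2 e3 -scale_row3 mulmx1.
have c a n b : a \in G -> b \in G -> commute (a ^+ (p * n)) b.
  by move=> Ga Gb; rewrite expgM (coordX co) // iotaX; apply: iota_central.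
(* The kernel part is a product of central p-th powers of the basis, each of which is merged into
   its own cyclic factor. *)
rewrite /y /powers3 -shuffle3; try by apply: c; rewrite ?groupX.
by rewrite -mulgA !mem_mulg // groupM ?mem_cycle.
Qed.

Lemma mem_prod_cycles (s : seq gT) a : a \in s -> a \in \prod_(b <- s) <[b]>.
Proof.
have one_in (t : seq gT) : 1 \in \prod_(b <- t) <[b]>.
  elim: t => [|b t IHt]; first by rewrite big_nil set11.
  by rewrite big_cons; apply/mulsgP; exists 1 1; rewrite ?group1 ?mulg1.
elim: s => // b s IHs; rewrite inE big_cons => /orP[/eqP->|/IHs as_]; apply/mulsgP.
  by exists b 1; rewrite ?cycle_id ?mulg1.
by exists 1 a; rewrite ?group1 ?mul1g.
Qed.

(** On [G] the p-th power map is the morphism obtained by following [pi] with [iota], so the p-th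
    powers of [H] already form a subgroup. *)
Lemma pth_powers_coord (H : {group gT}) y : H \subset G ->
  y \in pth_powers p H -> exists2 h, h \in H & y = iota (pi h).
Proof.
move=> /subsetP sHG; pose K := [set iota (pi h) | h in H].
have gK : group_set K.
  apply/group_setP; split; first by apply/imsetP; exists 1; rewrite ?group1 // coord1 iota0.
  move=> _ _ /imsetP[h Hh ->] /imsetP[k Hk ->]; apply/imsetP; exists (h * k).
    exact: groupM.
  by rewrite (coordM co) ?sHG // (iota_morphD co).
have : pth_powers p H \subset Group gK.
  rewrite gen_subG; apply/subsetP=> _ /imsetP[h Hh ->]; apply/imsetP; exists h => //.
  by rewrite (coordX co) ?sHG.
by move/subsetP=> sK /sK /imsetP[h Hh ->]; exists h.
Qed.

Lemma type_twos_nontrivial r (H : {group gT}) : H \subset G -> H :!=: 1 -> type_twos p r H ->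
  exists2 h, h \in H & pi h != 0%R.
Proof.
move=> /subsetP sHG ntH [_ [s [defH _] os]].
case: s => -[|h s] szs /= in defH os.
  by case/eqP: ntH; rewrite defH big_nil.
have hs : h \in h :: s by rewrite inE eqxx.
have Hh : h \in H by rewrite defH; apply: mem_prod_cycles.
exists h => //; apply/eqP=> h0.
have : h ^+ p = 1 by rewrite (coordX co) ?sHG // h0 iota0.
move/eqP; rewrite -order_dvdn os // => /dvdn_leq; rewrite prime_gt0 // => /(_ isT).
by apply/negP; rewrite -ltnNge -{1}[p]expn1 ltn_exp2l ?prime_gt1.
Qed.

(** The image of a powerfully embedded [H] under [pi] is an ideal, nonzero by
    [type_twos_nontrivial], hence everything by [ideal_full]. *)
Lemma coord_simple : A \in unitmx -> powerfully_simple p G.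
Proof.
move=> uA; split; first by exists 3; apply: coord_type_twos.
  by rewrite -cardG_gt1 (coord_card co) -(exp1n 6) ltn_exp2r ?prime_gt1.
move=> H [[r tH] _ /andP[sHG nsGH] [_ emb]]; apply/eqP/idPn => ntH.
have [w0 Hw0 w0n] := type_twos_nontrivial sHG ntH tH.
have sH := subsetP sHG.
pose U : 'M['F_p]_(#|H|, 3) := (\matrix_(i < #|H|) pi (enum_val i))%R.
have UP v : (v <= U)%MS -> exists2 h, h \in H & pi h = v.
  case/submxP=> d ->; rewrite mulmx_sum_row.
  pose P (v : 'rV['F_p]_3) := exists2 h, h \in H & pi h = v.
  apply: (big_ind P) => [|x y [h Hh <-] [k Hk <-]|i _].
  - by exists 1; rewrite ?group1 ?coord1.
  - by exists (h * k); rewrite ?groupM // (coordM co) ?sH.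
  - exists (enum_val i ^+ d 0%R i); first by rewrite groupX // enum_valP.
    by rewrite coord_exp ?sH ?enum_valP // natr_Zp rowK.
have HU h : h \in H -> (pi h <= U)%MS.
  by move=> Hh; rewrite -(enum_rankK_in Hh Hh) -(rowK (fun i => pi (enum_val i))) row_sub.
have fU : row_full U.
  apply: (ideal_full uA w0n (HU _ Hw0)) => v x /UP[h Hh <-].
  have [g Gg <-] := coord_surj co x.
  have : [~ h, g] \in pth_powers p H by apply: (subsetP emb _ (mem_commg Hh Gg)).
  case/(pth_powers_coord sHG)=> k Hk; rewrite (coordR co (sH _ Hh) Gg) => /(iota_inj co) ->.
  exact: HU.
(* Once [pi] maps [H] onto F_p^3, the p-th powers of [H] fill the kernel, so [H] is all of [G] and
   not proper. *)
case/negP: nsGH; apply/subsetP=> x Gx.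
have piH v : exists2 h, h \in H & pi h = v by apply: UP; rewrite submx_full.
have [h Hh hx] := piH (pi x); have [v ->] := coord_eq Gx (sH _ Hh) (esym hx).
by have [k Hk <-] := piH v; rewrite groupM // -(coordX co) ?groupX ?sH.
Qed.

(** Lifts [a], [b] of a basis of the plane generate a subgroup of type (2,2); all commutators of [G]
    are products of p-th powers of [a] and [b]. *)
Lemma rank2_ideal (M : 'M['F_p]_(2, 3)) : row_free M -> (A <= M)%MS ->
  exists H : {group gT}, normal_P p H G /\ H :!=: 1.
Proof.
move=> fM AM.
have [a Ga ea] := coord_surj co (row 0 M)%R.
have [b Gb eb] := coord_surj co (row 1 M)%R.
have l1 : lift ord0 ord0 = 1%R :> 'I_2 by apply: val_inj.
have inM (v : 'rV_3) : (v <= M)%MS -> exists c d : 'F_p,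
    v = (c *: pi a + d *: pi b)%R /\ iota v = a ^+ (p * c) * b ^+ (p * d).
  case/submxP=> d ->; exists (d 0 0)%R, (d 0 1)%R.
  have e : (d *m M = d 0 0 *: pi a + d 0 1 *: pi b)%R.
    by rewrite mulmx_sum_row big_ord_recl big_ord1 l1 ea eb.
  split=> //; rewrite e (iota_morphD co) !expgM !(coordX co) // !iotaX.
  by rewrite !natr_Zp.
have free2 (c d : 'F_p) : (c *: pi a + d *: pi b = 0 -> c = 0 /\ d = 0)%R.
  pose v : 'rV['F_p]_2 := (\row_i nth 0 [:: c; d] i)%R; move=> e.
  have /eqP : (v *m M = 0)%R.
    by rewrite mulmx_sum_row big_ord_recl big_ord1 l1 !mxE -[RHS]e ea eb.
  rewrite mulmx_free_eq0 // => /eqP/rowP z.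
  by have := z 0%R; have := z 1%R; rewrite !mxE.
have comM g h : g \in G -> h \in G -> exists c d : 'F_p,
    [~ g, h] = a ^+ (p * c) * b ^+ (p * d).
  move=> Gg Gh; rewrite (coordR co) //.
  have [|c [d [_ ->]]] := inM (crs (pi g) (pi h) *m A)%R; last by exists c, d.
  exact: submx_trans (submxMl _ _) AM.
have cen x n y : x \in G -> y \in G -> commute (x ^+ (p * n)) y.
  by move=> Gx Gy; rewrite expgM (coordX co) // iotaX; apply: iota_central.
have oa : #[a] = (p ^ 2)%N.
  apply: coord_order => //; apply/eqP=> a0; have [|/eqP] := free2 1%R 0%R.
    by rewrite a0 scaler0 scale0r addr0.
  by rewrite oner_eq0.
have ob : #[b] = (p ^ 2)%N.
  apply: coord_order => //; apply/eqP=> b0; have [|_ /eqP] := free2 0%R 1%R.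
    by rewrite b0 scaler0 scale0r addr0.
  by rewrite oner_eq0.
have gH : group_set (<[a]> * <[b]>).
  apply/comm_group_setP/eqP; rewrite eqEcard; apply/andP; split; last first.
    by rewrite -[X in _ <= X]card_invg invMg !invGid.
  apply/subsetP=> _ /mulsgP[_ _ /cycleP[i ->] /cycleP[j ->] ->].
  (* Exchanging the factors costs a central product of powers of [a] and [b], which is absorbed into
     them. *)
  rewrite (commgC (a ^+ i)); have [||c [d ->]] := comM (a ^+ i) (b ^+ j); rewrite ?groupX //.
  rewrite mulgA -(mulgA (b ^+ j)) -expgD -mulgA -(cen b) ?groupX // mulgA -expgD.
  by rewrite mem_mulg ?mem_cycle.
pose H := Group gH.
(* Independence is used twice: through [pi] it makes [i] and [j] multiples of [p], and through
   [iota] it makes the quotients multiples of [p] again. *)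
have tiab : <[a]> :&: <[b]> = 1.
  apply/trivgP/subsetP=> x /setIP[/cycleP[i xi] /cycleP[j xj]].
  have e1 : (i%:R *: pi a + (- j%:R) *: pi b = 0)%R.
    by rewrite -coord_exp // -xi xj coord_exp // scaleNr addrN.
  have [/eqP + /eqP] := free2 _ _ e1.
  rewrite oppr_eq0 -!(dvdn_pcharf (pchar_Fp p_pr)) => /dvdnP[k ek] /dvdnP[l el].
  have e2 : iota (k%:R *: pi a + (- l%:R) *: pi b)%R = 1.
    rewrite scaleNr (iota_morphD co) -[iota (- _)%R]mul1g.
    have iN v : iota (- v)%R = (iota v)^-1.
      by apply: (mulIg (iota v)); rewrite -(iota_morphD co) addNr iota0 mulVg.
    rewrite mul1g iN -!iotaX -!(coordX co) // -!expgM ![(p * _)%N]mulnC -ek -el.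
    by rewrite -xi -xj mulgV.
  have [k0 _] : (k%:R = 0 :> 'F_p /\ - l%:R = 0 :> 'F_p)%R.
    by apply: free2; apply: (iota_inj co); rewrite e2 iota0.
  by rewrite xi ek mulnC expgM (coordX co) // iotaX k0 scale0r iota0 inE.
have cardH : #|H| = (p ^ 4)%N.
  by rewrite /= TI_cardMg // -!orderE oa ob -expnD.
have sHG : H \subset G by rewrite /= mul_subG ?cycle_subG.
have Ha : a \in H by rewrite -[a]mulg1 mem_mulg ?cycle_id ?group1.
have Hb : b \in H by rewrite -[b]mul1g mem_mulg ?cycle_id ?group1.
have emb : [~: H, G] \subset pth_powers p H.
  rewrite gen_subG; apply/subsetP=> _ /imset2P[h g Hh Gg ->].
  have [c [d ->]] := comM h g (subsetP sHG _ Hh) Gg.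
  have pw x n : x \in H -> x ^+ (p * n) \in pth_powers p H.
    by move=> Hx; rewrite mulnC expgM; apply/mem_gen/imset_f; rewrite groupX.
  by apply: groupM; apply: pw.
exists H; split; last by rewrite -cardG_gt1 cardH -(exp1n 4) ltn_exp2r ?prime_gt1.
split.
- exists 2; split.
    split; first by apply: pgroupS coord_pgroup.
    exact: subset_trans (commgS _ sHG) emb.
  exists [tuple a; b]; last by move=> x; rewrite !inE => /orP[] /eqP->.
  split; first by rewrite !big_cons big_nil mulg1.
  by rewrite !big_cons big_nil oa ob muln1 -expnD cardH.
- by exists 3; apply: coord_type_twos.
- by rewrite properEcard sHG cardH (coord_card co) ltn_exp2l ?prime_gt1.
- by split.
Qed.

Lemma coord_simpleE : powerfully_simple p G <-> (\det A != 0)%R.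
Proof.
rewrite -unitfE -unitmxE; split=> [[_ _ simG]|]; last exact: coord_simple.
apply/idPn=> /singular_ideal[M fM AM].
have [H [nH ntH]] := rank2_ideal fM AM.
by rewrite (simG H nH) eqxx in ntH.
Qed.

End CoordinateTheory.

(** * From bases and listed relations to matrices *)

Section Relations.

Import GRing.Theory.

Variables (p : nat).
Hypotheses (p_pr : prime p) (p_odd : odd p).

Lemma exp_Fp_nat (gT : finGroupType) (a : gT) n : a ^+ (p ^ 2) = 1 ->
  a ^+ (p * (n%:R%R : 'F_p)) = a ^+ (p * n).
Proof.
move=> oa; rewrite !expgM val_Fp_nat // expg_mod //.
by rewrite -expgM mulnn.
Qed.

Lemma exp_FpD (gT : finGroupType) (a : gT) (x y : 'F_p) : a ^+ (p ^ 2) = 1 ->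
  a ^+ (p * (x + y)%R) = a ^+ (p * x) * a ^+ (p * y).
Proof.
move=> oa; rewrite -{1}[x]natr_Zp -{1}[y]natr_Zp -natrD exp_Fp_nat //.
by rewrite mulnDr expgD.
Qed.

Lemma exp_FpN (gT : finGroupType) (a : gT) (x : 'F_p) : a ^+ (p ^ 2) = 1 ->
  a ^+ (p * (- x)%R) = a ^- (p * x).
Proof.
by move=> oa; apply: (mulIg (a ^+ (p * x))); rewrite -exp_FpD // addNr muln0 mulVg.
Qed.

Lemma exp_Fp_int (gT : finGroupType) (a : gT) (z : int) : a ^+ (p ^ 2) = 1 ->
  a ^+ (p * (z%:~R%R : 'F_p)) = expgz a (p%:Z * z)%R.
Proof.
move=> oa; case: z => n; first by rewrite -PoszM /= -pmulrn exp_Fp_nat.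
rewrite NegzE mulrNz exp_FpN // -pmulrn exp_Fp_nat // mulrN -PoszM.
by case: (p * n.+1)%N => //; rewrite invg1.
Qed.

(** The products [powers3] form a subgroup containing the generators of ['Mho^1(G)], hence all
    commutators; their exponents are the rows of the matrix. *)
Lemma type_twos_frame (gT : finGroupType) (G : {group gT}) : type_twos p 3 G ->
  [/\ powerful p G, #|G| = (p ^ 6)%N & exists (A : 'M['F_p]_3) a1 a2 a3, frame G A a1 a2 a3].
Proof.
case=> powG [s [defG cardG] os].
case: s => -[|a1 [|a2 [|a3 [|]]]] //= sz in defG cardG os *.
have inG a : a \in [:: a1; a2; a3] -> a \in G.
  by rewrite [in X in _ -> X]defG; apply: mem_prod_cycles.
rewrite !big_cons !big_nil in defG cardG.
have o1 : #[a1] = (p ^ 2)%N by apply: os; rewrite !inE eqxx.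
have o2 : #[a2] = (p ^ 2)%N by apply: os; rewrite !inE eqxx orbT.
have o3 : #[a3] = (p ^ 2)%N by apply: os; rewrite !inE eqxx !orbT.
have e1 : a1 ^+ (p ^ 2) = 1 by rewrite -o1 expg_order.
have e2 : a2 ^+ (p ^ 2) = 1 by rewrite -o2 expg_order.
have e3 : a3 ^+ (p ^ 2) = 1 by rewrite -o3 expg_order.
rewrite mulg1 in defG.
have [G1 G2 G3] : [/\ a1 \in G, a2 \in G & a3 \in G].
  by split; apply: inG; rewrite !inE eqxx ?orbT.
have genG : <<[set a1; a2; a3]>> = G.
  apply/eqP; rewrite eqEsubset; apply/andP; split.
    by rewrite gen_subG; apply/subsetP=> x; rewrite !inE -orbA => /or3P[] /eqP->.
  by rewrite defG !mul_subG // cycle_subG mem_gen // !inE eqxx ?orbT.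
split=> //; first by rewrite cardG o1 o2 o3 muln1 -!expnD.
have [|eN _ sGN cNG _] := powerful_gen_exp2 p_pr p_odd powG genG.
  by move=> x; rewrite !inE -orbA => /or3P[] /eqP->.
have pG : p.-group G by case: powG.
have cen a n b : a \in G -> b \in G -> commute (a ^+ (p * n)) b.
  move=> Ga Gb; rewrite expgM; apply: commute_sym; apply: commuteX; apply: commute_sym.
  exact: (centP (subsetP cNG _ (mho_exp pG Ga))).
have P3D u v : powers3 a1 a2 a3 (u + v : 'rV['F_p]_3)%R = powers3 a1 a2 a3 u * powers3 a1 a2 a3 v.
  by rewrite /powers3 !mxE !exp_FpD //; apply: shuffle3; apply: cen; rewrite ?groupX.
pose K := [set powers3 a1 a2 a3 v | v : 'rV['F_p]_3].
have P3_0 : powers3 a1 a2 a3 (0 : 'rV['F_p]_3)%R = 1.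
  by rewrite /powers3 !mxE !muln0 !mulg1.
have gK : group_set K.
  apply/group_setP; split; first by apply/imsetP; exists 0%R; rewrite ?P3_0.
  by move=> _ _ /imsetP[u _ ->] /imsetP[v _ ->]; rewrite -P3D; apply: imset_f.
have sNK : 'Mho^1(G) \subset Group gK.
  have one : ((1%R : 'F_p) : nat) = 1%N by [].
  rewrite eN gen_subG; apply/subsetP=> _ /imsetP[x + ->].
  rewrite !inE -orbA => /or3P[] /eqP->; apply/imsetP.
  - by exists (rv3 1 0 0)%R; rewrite // /powers3 !mxE /= !muln0 ?one muln1 !mulg1.
  - by exists (rv3 0 1 0)%R; rewrite // /powers3 !mxE /= !muln0 ?one muln1 mulg1 mul1g.
  - by exists (rv3 0 0 1)%R; rewrite // /powers3 !mxE /= !muln0 ?one muln1 !mul1g.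
have com x y : x \in G -> y \in G -> exists v : 'rV['F_p]_3, [~ x, y] = powers3 a1 a2 a3 v.
  move=> Gx Gy; have : [~ x, y] \in Group gK.
    exact: (subsetP sNK _ (subsetP sGN _ (mem_commg Gx Gy))).
  by case/imsetP=> v _ ->; exists v.
have [v0 h0] := com _ _ G2 G3; have [v1 h1] := com _ _ G3 G1; have [v2 h2] := com _ _ G1 G2.
exists (\matrix_(i < 3) nth 0 [:: v0; v1; v2] i)%R, a1, a2, a3.
by split=> //; split; rewrite rowK.
Qed.

Variable tau : int.

Lemma powers3_row (gT : finGroupType) (a1 a2 a3 : gT) (a b c d e f g h i : 'F_p) :
  let P k := powers3 a1 a2 a3 (row k (mx3 a b c d e f g h i)) in
  [/\ P 0%R = a1 ^+ (p * a) * a2 ^+ (p * b) * a3 ^+ (p * c),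
      P 1%R = a1 ^+ (p * d) * a2 ^+ (p * e) * a3 ^+ (p * f) &
      P (2%:R)%R = a1 ^+ (p * g) * a2 ^+ (p * h) * a3 ^+ (p * i)].
Proof. by split; rewrite /powers3 !mxE. Qed.

Lemma commutator_valuesE (gT : finGroupType) (l : label p) (a1 a2 a3 : gT) :
    a1 ^+ (p ^ 2) = 1 -> a2 ^+ (p ^ 2) = 1 -> a3 ^+ (p ^ 2) = 1 ->
  commutator_values tau l a1 a2 a3 =
  (powers3 a1 a2 a3 (row 0 (label_mx tau l)), powers3 a1 a2 a3 (row 1 (label_mx tau l)),
   powers3 a1 a2 a3 (row (2%:R) (label_mx tau l)))%R.
Proof.
move=> o1 o2 o3; have one : ((1%R : 'F_p) : nat) = 1%N by [].
have E0 (a : gT) : a ^+ (p * (0%R : 'F_p)) = 1 by rewrite muln0.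
have E1 (a : gT) : a ^+ (p * (1%R : 'F_p)) = a ^+ p by rewrite one muln1.
case: l => [|||||i|||||||i|||]; rewrite /label_mx /blk /commutator_values;
  match goal with |- context [mx3 ?a ?b ?c ?d ?e ?f ?g ?h ?i] =>
    have [-> -> ->] := powers3_row a1 a2 a3 a b c d e f g h i end;
  rewrite ?(sub0r, subr0, add0r, addr0, oppr0) ?exp_FpN // ?exp_Fp_nat //;
  rewrite ?exp_Fp_int // ?E0 ?E1 ?mulg1 ?mul1g //.
Qed.

Lemma satisfies_relationsE (gT : finGroupType) (G : {group gT}) (l : label p) :
  satisfies_relations tau l G <->
  [/\ powerful p G, #|G| = (p ^ 6)%N &
      exists a1 a2 a3, frame G (label_mx tau l) a1 a2 a3].
Proof.
split=> -[powG cardG [a1 [a2 [a3 [defG [o1 o2 o3] rel]]]]]; split=> //;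
  exists a1, a2, a3; split=> //; rewrite commutator_valuesE // in rel *.
  by case: rel => -> -> ->.
by case: rel => -> -> ->.
Qed.

End Relations.

(** * Counting the labels and assembling the classification *)

Lemma enum_label (p : nat) : Finite.enum (label p) = label_enum p.
Proof. by rewrite unlock. Qed.

Lemma card_label (p : nat) : 1 < p -> #|{: label p}| = (12 + 2 * (p - 1))%N.
Proof.
move=> p1; rewrite cardE enumT enum_label /label_enum !size_cat !size_map -!enumT size_enum_ord /=.
by lia.
Qed.

Lemma card_is_A (p : nat) : #|[set l : label p | is_A l]| = (5 + (p - 2))%N.
Proof.
rewrite cardsE cardE /enum_mem size_filter enum_label /label_enum !count_cat !count_map /=.
rewrite (eq_count (a2 := predT)) // count_predT -enumT size_enum_ord.
by rewrite (eq_count (a2 := pred0)) // count_pred0; lia.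
Qed.

Theorem mainTheorem7 (p : nat) (p_prime : prime p) (p_odd : odd p)
    (tau : int) (tau_nonsquare : forall x : 'F_p, (x ^+ 2 != tau%:~R)%R) :
  exists K : label p -> finGroupType,
    [/\ (* K l is, up to isomorphism, the group given by the relations of l *)
        forall (l : label p) (gT : finGroupType) (G : {group gT}),
          satisfies_relations tau l G <-> G \isog [set: K l],
        (* the powerful p-groups of type (2,2,2) are exactly the groups K l *)
        forall (gT : finGroupType) (G : {group gT}),
          type_twos p 3 G <-> exists l : label p, G \isog [set: K l],
        (* the groups K l are pairwise non-isomorphic *)
        (forall l1 l2 : label p,
           l1 != l2 -> ~~ ([set: K l1] \isog [set: K l2]))
        /\ #|{: label p}| = (12 + 2 * (p - 1))%N &
        (* the powerfully simple ones *)
        [/\ forall l : label p, powerfully_simple p [set: K l]%G <-> is_A l,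
            forall (gT : finGroupType) (G : {group gT}),
              powerfully_simple p G /\ #|G| = (p ^ 6)%N <->
              exists2 l : label p, is_A l & G \isog [set: K l] &
            #|[set l : label p | is_A l]| = (5 + (p - 2))%N]].
Proof.
pose K (l : label p) := model p_prime (label_mx tau l).
have isoK l (gT : finGroupType) (G : {group gT}) :
    G \isog [set: K l] -> has_coordinates G (label_mx tau l).
  by move=> iGK; apply: coordinates_isog iGK (model_coordinates p_prime p_odd _).
have relK l (gT : finGroupType) (G : {group gT}) :
    satisfies_relations tau l G <-> G \isog [set: K l].
  rewrite satisfies_relationsE //; split=> [[powG cardG [a1 [a2 [a3 fr]]]] | /isoK[pi [iota co]]].
    exact: (frame_isog p_prime p_odd powG cardG fr).
  split; [exact: (coord_powerful p_prime co) | exact: (coord_card co) |].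
  by apply/(frame_sim p_prime co)/sim_refl.
have typeK (gT : finGroupType) (G : {group gT}) :
    type_twos p 3 G <-> exists l, G \isog [set: K l].
  split=> [/(type_twos_frame p_prime p_odd)[powG cardG [A [a1 [a2 [a3 fr]]]]]|].
    have [l sl] := label_mx_complete p_prime p_odd tau_nonsquare A.
    have iGA := frame_isog p_prime p_odd powG cardG fr.
    have [pi [iota co]] := coordinates_isog iGA (model_coordinates p_prime p_odd A).
    exists l; apply/relK/satisfies_relationsE => //; split=> //.
    exact/(frame_sim p_prime co).
  by case=> l /isoK[pi [iota co]]; apply: (coord_type_twos p_prime co).
have simpleK l (gT : finGroupType) (G : {group gT}) :
    G \isog [set: K l] -> powerfully_simple p G <-> is_A l.
  by move=> /isoK[pi [iota co]]; rewrite (coord_simpleE p_prime co) label_mx_det.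
exists K; split=> //; first split.
- move=> l1 l2; apply: contra => i12; apply/eqP.
  (* The isomorphism gives [K l1] coordinates with the matrix of [l2], while it also has a frame for
     that of [l1]; [frame_sim] compares them. *)
  have [pi [iota co]] := isoK l2 _ _ i12.
  have /satisfies_relationsE[//|_ _ fr] := (relK l1 _ [set: K l1]%G).2 (isog_refl _).
  apply/esym; apply: (label_mx_inj p_prime p_odd tau_nonsquare).
  exact/(frame_sim p_prime co).
- by apply: card_label; apply: prime_gt1.
split; last exact: card_is_A.
  by move=> l; apply: simpleK; apply: isog_refl.
move=> gT G; split=> [[simG cardG] | [l Al iGK]]; last first.
  split; first by apply/(simpleK l).
  by have [pi [iota co]] := isoK l _ _ iGK; apply: (coord_card co).
have [[r tG] _ _] := simG.
(* A basis of [r] elements of order p^2 gives order p^(2r), to be matched with p^6. *)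
have r3 : r = 3.
  case: tG => _ [s [_ cG] os]; rewrite cardG in cG.
  move: cG; rewrite (eq_big_seq (fun=> p ^ 2)%N) // big_const_seq count_predT size_tuple.
  rewrite iter_muln_1 -expnM => /eqP; rewrite eqn_exp2l ?prime_gt1 //.
  by rewrite (_ : 6 = 2 * 3)%N // eqn_mul2l /= => /eqP.
rewrite r3 in tG; have [l iGK] := (typeK gT G).1 tG.
by exists l => //; apply/(simpleK l _ G).
Qed.
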